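(* Let $k$ be a commutative Noetherian ring and let $l\ge 2$ be an integer. The categories $\operatorname{Rep}_k(\mathcal{T}^{\mathrm{op}})$, $\operatorname{Rep}_k(\mathcal{RT}^{\mathrm{op}})$, and $\operatorname{Rep}_k(\mathcal{T}_l^{\mathrm{op}})$ are all locally Noetherian.
   Context: A tree is a finite nonempty connected acyclic graph; a leaf is a vertex of degree 1. A contraction $\varphi:T\to T'$ of trees is a map on vertex sets such that adjacent vertices of $T$ are sent to equal or adjacent vertices of $T'$, and the preimage of every vertex of $T'$ is the vertex set of a (nonempty, connected) subtree of $T$. Let $\mathcal{T}$ be the category of trees with contractions as morphisms. A rooted tree is a tree with a chosen vertex (the root); let $\mathcal{RT}$ be the category of rooted trees with contractions that send root to root. For an integer $l\ge 2$, let $\mathcal{T}_l\subset\mathcal{T}$ be the full subcategory of trees with at most $l$ leaves. For an essentially small category $\mathcal{C}$, a $\mathcal{C}$-module is a covariant functor from $\mathcal{C}$ to the category of $k$-modules, and $\operatorname{Rep}_k(\mathcal{C})$ is the abelian category of $\mathcal{C}$-modules. For an object $x$ of $\mathcal{C}$, the principal projective $P_x$ is the $\mathcal{C}$-module for which $P_x(y)$ is the free $k$-module with basis $\operatorname{Hom}_{\mathcal{C}}(x,y)$, with morphisms acting by composition. A $\mathcal{C}$-module is finitely generated if it admits a surjection from a finite direct sum of principal projectives. $\operatorname{Rep}_k(\mathcal{C})$ is locally Noetherian if every submodule of a finitely generated $\mathcal{C}$-module is finitely generated. *)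

(* Defs.v *)
From HB Require Import structures.
From mathcomp Require Import all_boot all_order all_algebra.

Set Implicit Arguments.
Unset Strict Implicit.
Unset Printing Implicit Defensive.

Import GRing.Theory.

Local Open Scope ring_scope.

(* Ideals are Prop-valued predicates, so that no ideal is excluded for lack of
   a decision procedure. *)
Definition ideal (k : comPzRingType) (I : k -> Prop) : Prop :=
  [/\ I 0, forall a b, I a -> I b -> I (a + b) & forall c a, I a -> I (c * a)].

Definition noetherian_ring (k : comPzRingType) : Prop :=
  forall I : k -> Prop, ideal I ->
  exists (n : nat) (g : 'I_n -> k), (forall i, I (g i)) /\
    forall a, I a -> exists c : 'I_n -> k, a = \sum_i c i * g i.

(* Hom-sets are finite, which holds for every category of finite trees; the free
   k-module on a Hom-set is then the module of all k-valued functions on it. *)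
Record category := Category {
  obj :> Type;
  hom : obj -> obj -> finType;
  idm : forall x, hom x x;
  comp : forall x y z, hom y z -> hom x y -> hom x z;
  comp1m : forall x y (f : hom x y), comp (idm y) f = f;
  compm1 : forall x y (f : hom x y), comp f (idm x) = f;
  compA : forall w x y z (h : hom y z) (g : hom x y) (f : hom w x),
    comp h (comp g f) = comp (comp h g) f }.

Arguments hom {c} x y.
Arguments idm {c} x.
Arguments comp {c x y z} g f.

Definition op (C : category) : category :=
  @Category C (fun x y => hom y x) idm (fun x y z g f => comp f g)
    (fun x y f => compm1 f) (fun x y f => comp1m f)
    (fun w x y z h g f => esym (compA f g h)).

Definition full_subcategory (C : category) (P : C -> Prop) : category :=
  @Category {x : C | P x} (fun x y => hom (sval x) (sval y))
    (fun x => idm (sval x)) (fun x y z g f => comp g f)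
    (fun x y f => comp1m f) (fun x y f => compm1 f)
    (fun w x y z h g f => compA h g f).

Section Modules.
Variables (k : comPzRingType) (C : category).

Record cmodule := CModule {
  cmod :> C -> lmodType k;
  act : forall x y : C, hom x y -> {linear cmod x -> cmod y};
  act1 : forall x (v : cmod x), act (idm x) v = v;
  actM : forall x y z (g : hom y z) (f : hom x y) (v : cmod x),
    act (comp g f) v = act g (act f v) }.

Arguments act : clear implicits.
Arguments act M {x y} f : rename.

Record cmod_hom (M N : cmodule) := CModHom {
  component :> forall x : C, {linear M x -> N x};
  naturality : forall x y (f : hom x y) (v : M x),
    component y (act M f v) = act N f (component x v) }.

Definition cmod_injective (M N : cmodule) (u : cmod_hom M N) : Prop :=
  forall x, injective (u x).

Definition cmod_surjective (M N : cmodule) (u : cmod_hom M N) : Prop :=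
  forall x (w : N x), exists v, u x v = w.

(* f \in hom y z sends the basis element g \in hom x y to comp f g. *)
Section Principal.
Variable x : C.

Definition principal_obj (y : C) : lmodType k := {ffun hom x y -> k^o}.

Definition principal_act_fun y z (f : hom y z) (a : principal_obj y) :
    principal_obj z :=
  [ffun h => \sum_(g | comp f g == h) a g].

Fact principal_act_is_linear y z (f : hom y z) : linear (principal_act_fun f).
Proof.
move=> c a b; apply/ffunP=> h; rewrite !ffunE scaler_sumr -big_split /=.
by apply: eq_bigr => g _; rewrite !ffunE.
Qed.

HB.instance Definition _ y z (f : hom y z) :=
  GRing.isLinear.Build k (principal_obj y) (principal_obj z) _
    (principal_act_fun f) (principal_act_is_linear f).

Definition principal_act y z (f : hom y z) :
    {linear principal_obj y -> principal_obj z} := principal_act_fun f.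

Fact principal_act1 y (a : principal_obj y) : principal_act (idm y) a = a.
Proof.
apply/ffunP=> h; rewrite ffunE (big_pred1 h) // => g.
by rewrite comp1m.
Qed.

Fact principal_actM w y z (g : hom y z) (f : hom w y) (a : principal_obj w) :
  principal_act (comp g f) a = principal_act g (principal_act f a).
Proof.
apply/ffunP=> h; rewrite !ffunE.
rewrite (partition_big (fun u => comp f u) (fun v => comp g v == h)) /=.
  apply: eq_bigr => v /eqP <-; rewrite ffunE; apply: eq_bigl => u.
  rewrite -compA andbC; case: eqP => //= ->; exact: eqxx.
by move=> u /eqP <-; rewrite compA.
Qed.

Definition principal : cmodule :=
  @CModule principal_obj principal_act principal_act1 principal_actM.

End Principal.

Definition cmod_zero : cmodule :=
  @CModule (fun=> 'rV[k]_0 : lmodType k) (fun _ _ _ => idfun)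
    (fun _ _ => erefl) (fun _ _ _ _ _ _ => erefl).

Section DirectSum.
Variables M N : cmodule.

Definition dsum_obj (x : C) : lmodType k := (M x * N x)%type.

Definition dsum_act_fun x y (f : hom x y) (v : dsum_obj x) : dsum_obj y :=
  (act M f v.1, act N f v.2).

Fact dsum_act_is_linear x y (f : hom x y) : linear (dsum_act_fun f).
Proof. by move=> c a b; rewrite /dsum_act_fun /= !linearP. Qed.

HB.instance Definition _ x y (f : hom x y) :=
  GRing.isLinear.Build k (dsum_obj x) (dsum_obj y) _
    (dsum_act_fun f) (dsum_act_is_linear f).

Definition dsum_act x y (f : hom x y) : {linear dsum_obj x -> dsum_obj y} :=
  dsum_act_fun f.

Fact dsum_act1 x (v : dsum_obj x) : dsum_act (idm x) v = v.
Proof. by case: v => a b; rewrite /= /dsum_act_fun /= !act1. Qed.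

Fact dsum_actM x y z (g : hom y z) (f : hom x y) (v : dsum_obj x) :
  dsum_act (comp g f) v = dsum_act g (dsum_act f v).
Proof. by rewrite /= /dsum_act_fun /= !actM. Qed.

Definition dsum : cmodule := @CModule dsum_obj dsum_act dsum_act1 dsum_actM.

End DirectSum.

Definition direct_sum (Ms : seq cmodule) : cmodule := foldr dsum cmod_zero Ms.

Definition finitely_generated (M : cmodule) : Prop :=
  exists (xs : seq C) (u : cmod_hom (direct_sum (map principal xs)) M),
    cmod_surjective u.

(* A submodule of M is given by an injective morphism N -> M. *)
Definition rep_locally_noetherian : Prop :=
  forall (M N : cmodule) (i : cmod_hom N M),
    finitely_generated M -> cmod_injective i -> finitely_generated N.

End Modules.

Arguments act {k C} M {x y} f : rename.

Section Graphs.
Variables (V : finType) (e : rel V).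

Definition connected : bool :=
  (0 < #|V|)%N && [forall x, forall y, connect e x y].

(* The size bound discards the backtracking cycles x - y - x. *)
Definition acyclic : Prop := forall p : seq V, ucycle e p -> (size p <= 2)%N.

Definition induced (A : {set V}) : rel {x : V | x \in A} :=
  fun x y => e (val x) (val y).

End Graphs.

Arguments induced {V} e A x y.

Record tree := Tree {
  vertex :> finType;
  adj : rel vertex;
  adj_sym : symmetric adj;
  adj_irr : irreflexive adj;
  tree_connected : connected adj;
  tree_acyclic : acyclic adj }.

Arguments adj {t}.

Definition leaves (T : tree) : {set T} := [set x | #|[set y | adj x y]| == 1%N].

(* The subgraphs of a tree that are trees are its induced nonempty connected
   subgraphs: see induced_acyclic. *)
Definition contractionb (T T' : tree) (f : {ffun T -> T'}) : bool :=
  [forall x, forall y, adj x y ==> (f x == f y) || adj (f x) (f y)] &&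
  [forall z, connected (induced adj (f @^-1: [set z]))].

Definition contraction (T T' : tree) := {f : {ffun T -> T'} | contractionb f}.

Lemma induced_acyclic (V : finType) (e : rel V) (A : {set V}) :
  acyclic e -> acyclic (induced e A).
Proof.
move=> ac p /andP[cp up]; rewrite -(size_map val); apply: ac.
rewrite /ucycle (map_inj_uniq val_inj) up andbT.
by case: p cp {up} => //= x p; rewrite -map_rcons path_map.
Qed.

Lemma connect_homo (V W : finType) (e : rel V) (e' : rel W) (h : V -> W) :
  (forall a b, e a b -> connect e' (h a) (h b)) ->
  forall a b, connect e a b -> connect e' (h a) (h b).
Proof.
move=> he a b /connectP[p + ->]; elim: p a => [|c p IHp] a //= /andP[/he ac pp].
exact: connect_trans ac (IHp _ pp).
Qed.

Section Contractions.
Variables (T T' : tree) (f : {ffun T -> T'}).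
Hypothesis fc : contractionb f.

Lemma contraction_adj x y : adj x y -> f x = f y \/ adj (f x) (f y).
Proof.
case/andP: fc => /forallP/(_ x)/forallP/(_ y)/implyP fa _ /fa.
by case/orP=> [/eqP|]; [left | right].
Qed.

Lemma contraction_surj z : exists x, f x = z.
Proof.
case/andP: fc => _ /forallP/(_ z)/andP[/card_gt0P[[x xz] _] _].
by exists x; apply/eqP; rewrite !inE in xz.
Qed.

Lemma contraction_lift_adj u v :
  adj u v -> exists x y, [/\ f x = u, f y = v & adj x y].
Proof.
move=> uv.
pose r := [rel a b | [exists x, exists y,
  [&& f x == a, f y == b, adj x y & a != b]]].
have r_adj a b : r a b -> adj a b.
  case/existsP=> x /existsP[y] /and4P[/eqP <- /eqP <- xy].
  by case: (contraction_adj xy) => [->|//]; rewrite eqxx.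
have [x fx] := contraction_surj u; have [y fy] := contraction_surj v.
have : connect r (f x) (f y).
  apply: (@connect_homo _ _ adj).
    move=> a b ab; have [->//|nab] := eqVneq (f a) (f b).
    apply: connect1; apply/existsP; exists a; apply/existsP; exists b.
    by rewrite !eqxx ab.
  by case/andP: (tree_connected T) => _ /forallP/(_ x)/forallP.
rewrite fx fy => /connectP[p0 rp0 def_v].
case/shortenP: rp0 def_v => p rp up _ def_v {p0}.
case: p rp up def_v => [|b [|c p]] rp up def_v.
- by rewrite def_v /= adj_irr in uv.
- rewrite def_v /=; move: rp; rewrite /= andbT.
  case/existsP=> a' /existsP[b'] /and4P[/eqP <- /eqP <- ab _].
  by exists a', b'.
- have /(@tree_acyclic T') // : ucycle adj (u :: b :: c :: p).
  rewrite /ucycle up andbT /cycle rcons_path (sub_path r_adj rp) /=.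
  by rewrite -[last c p]/(last u [:: b, c & p]) -def_v adj_sym.
Qed.

Lemma contraction_preim_connected (A : {set T'}) :
  connected (induced adj A) -> connected (induced adj (f @^-1: A)).
Proof.
case/andP=> /card_gt0P[[z zA] _] /forallP cA; apply/andP; split.
  have [x fx] := contraction_surj z.
  have xA : x \in f @^-1: A by rewrite inE fx.
  by apply/card_gt0P; exists (Sub x xA).
pose V := {x : T | x \in f @^-1: A}; set e := induced _ _.
have fib (x y : V) : f (val x) = f (val y) -> connect e x y.
  move=> fxy; pose B := f @^-1: [set f (val y)].
  have BA w : w \in B -> w \in f @^-1: A.
    by rewrite !inE => /eqP ->; have := valP y; rewrite inE.
  pose h (w : {w : T | w \in B}) : V := Sub (val w) (BA _ (valP w)).
  have xB : val x \in B by rewrite !inE fxy.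
  have yB : val y \in B by rewrite !inE.
  have -> : x = h (Sub (val x) xB) by apply: val_inj.
  have -> : y = h (Sub (val y) yB) by apply: val_inj.
  apply: (@connect_homo _ _ (induced adj B)) => [a b ab|]; first exact: connect1.
  case/andP: fc => _ /forallP/(_ (f (val y)))/andP[_].
  by move=> /forallP/(_ (Sub (val x) xB))/forallP.
have fA (x : V) : f (val x) \in A by have := valP x; rewrite inE.
apply/forallP=> x; apply/forallP=> y.
have /connectP[p] := forallP (cA (Sub (f (val x)) (fA x))) (Sub (f (val y)) (fA y)).
elim: p x => [|c p IHp] x /=.
  by move=> _ /(congr1 val) /= fxy; apply: fib.
case/andP=> /contraction_lift_adj[x' [y' [fx' fy' xy']]] pp def_y.
have x'A : x' \in f @^-1: A by rewrite inE fx' /= fA.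
have y'A : y' \in f @^-1: A by rewrite inE fy' (valP c).
apply: (connect_trans (fib x (Sub x' x'A) _)); first by rewrite /= fx'.
apply: (connect_trans (connect1 (_ : e (Sub x' x'A) (Sub y' y'A)))) => //.
have cE : c = Sub (f (val (Sub y' y'A : V))) (fA _) by apply: val_inj; rewrite /= fy'.
by apply: IHp; rewrite -cE.
Qed.

End Contractions.

Fact contraction_id_subproof (T : tree) : contractionb [ffun x : T => x].
Proof.
apply/andP; split.
  by apply/forallP=> x; apply/forallP=> y; rewrite !ffunE; apply/implyP=> ->; rewrite orbT.
apply/forallP=> z; apply/andP; split.
  have zz : z \in [ffun x : T => x] @^-1: [set z] by rewrite !inE ffunE.
  by apply/card_gt0P; exists (Sub z zz).
apply/forallP=> x; apply/forallP=> y; have -> : x = y; last exact: connect0.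
apply: val_inj; have := valP y; have := valP x.
by rewrite !inE !ffunE => /eqP -> /eqP ->.
Qed.

Definition contraction_id (T : tree) : contraction T T :=
  exist (fun f => contractionb f) _ (contraction_id_subproof T).

Fact contraction_comp_subproof (T1 T2 T3 : tree)
    (g : contraction T2 T3) (f : contraction T1 T2) :
  contractionb [ffun x => val g (val f x)].
Proof.
apply/andP; split.
  apply/forallP=> x; apply/forallP=> y; rewrite !ffunE; apply/implyP=> xy.
  case: (contraction_adj (valP f) xy) => [->|fxy]; first by rewrite eqxx.
  by case: (contraction_adj (valP g) fxy) => [->|->]; rewrite ?eqxx ?orbT.
apply/forallP=> z.
have -> : [ffun x => val g (val f x)] @^-1: [set z]
    = val f @^-1: (val g @^-1: [set z]).
  by apply/setP=> x; rewrite !inE ffunE.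
apply: (contraction_preim_connected (valP f)).
by case/andP: (valP g) => _ /forallP.
Qed.

Definition contraction_comp (T1 T2 T3 : tree)
    (g : contraction T2 T3) (f : contraction T1 T2) : contraction T1 T3 :=
  exist (fun f => contractionb f) _ (contraction_comp_subproof g f).

Fact contraction_comp1m (T1 T2 : tree) (f : contraction T1 T2) :
  contraction_comp (contraction_id T2) f = f.
Proof. by apply: val_inj; apply/ffunP=> x /=; rewrite !ffunE. Qed.

Fact contraction_compm1 (T1 T2 : tree) (f : contraction T1 T2) :
  contraction_comp f (contraction_id T1) = f.
Proof. by apply: val_inj; apply/ffunP=> x /=; rewrite !ffunE. Qed.

Fact contraction_compA (T1 T2 T3 T4 : tree) (h : contraction T3 T4)
    (g : contraction T2 T3) (f : contraction T1 T2) :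
  contraction_comp h (contraction_comp g f)
  = contraction_comp (contraction_comp h g) f.
Proof. by apply: val_inj; apply/ffunP=> x /=; rewrite !ffunE. Qed.

Definition trees : category :=
  @Category tree (fun T T' => contraction T T' : finType)
    contraction_id contraction_comp
    contraction_comp1m contraction_compm1 contraction_compA.

Definition trees_le (l : nat) : category :=
  @full_subcategory trees (fun T : tree => (#|leaves T| <= l)%N).

Record rooted_tree := RootedTree {
  underlying_tree :> tree;
  root_vertex : underlying_tree }.

Definition rooted_contraction (T T' : rooted_tree) :=
  {f : contraction T T' | val f (root_vertex T) == root_vertex T'}.

Fact rooted_id_subproof (T : rooted_tree) :
  val (contraction_id T) (root_vertex T) == root_vertex T.
Proof. by rewrite /= ffunE. Qed.

Definition rooted_id (T : rooted_tree) : rooted_contraction T T :=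
  exist (fun f : contraction T T => val f (root_vertex T) == root_vertex T)
    _ (rooted_id_subproof T).

Fact rooted_comp_subproof (T1 T2 T3 : rooted_tree)
    (g : rooted_contraction T2 T3) (f : rooted_contraction T1 T2) :
  val (contraction_comp (val g) (val f)) (root_vertex T1) == root_vertex T3.
Proof. by rewrite /= ffunE (eqP (valP f)) (eqP (valP g)). Qed.

Definition rooted_comp (T1 T2 T3 : rooted_tree)
    (g : rooted_contraction T2 T3) (f : rooted_contraction T1 T2) :
    rooted_contraction T1 T3 :=
  exist (fun h : contraction T1 T3 => val h (root_vertex T1) == root_vertex T3)
    _ (rooted_comp_subproof g f).

Fact rooted_comp1m (T1 T2 : rooted_tree) (f : rooted_contraction T1 T2) :
  rooted_comp (rooted_id T2) f = f.
Proof. by apply: val_inj; apply: contraction_comp1m. Qed.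

Fact rooted_compm1 (T1 T2 : rooted_tree) (f : rooted_contraction T1 T2) :
  rooted_comp f (rooted_id T1) = f.
Proof. by apply: val_inj; apply: contraction_compm1. Qed.

Fact rooted_compA (T1 T2 T3 T4 : rooted_tree) (h : rooted_contraction T3 T4)
    (g : rooted_contraction T2 T3) (f : rooted_contraction T1 T2) :
  rooted_comp h (rooted_comp g f) = rooted_comp (rooted_comp h g) f.
Proof. by apply: val_inj; apply: contraction_compA. Qed.

Definition rooted_trees : category :=
  @Category rooted_tree (fun T T' => rooted_contraction T T' : finType)
    rooted_id rooted_comp rooted_comp1m rooted_compm1 rooted_compA.

(* Main.v *)
From HB Require Import structures.
Require Import Defs.
From mathcomp Require Import all_boot all_order all_algebra.
From mathcomp Require Import boolp zify.
(* Makes hom and comp denote the operations of a category again. *)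
Import Defs.

(** Why the theorem holds. The argument is a Groebner basis argument in the
style of Sam and Snowden, with Kruskal's tree theorem in the role of Dickson's
lemma.

A principal projective of T^op at a tree T0 sends a tree S to the free module
on the contractions S -> T0, and h : S -> T acts on a basis element f : T -> T0
by f |-> f o h. Treat the basis elements as monomials, and suppose that each
set of contractions S -> T0 carries a strict total order. Say that f divides g
when g = f o h for some contraction h such that precomposition with h sends
everything below f below g. The leading coefficients at f of the elements of a
submodule then form an ideal of k, which can only grow when f is replaced by
one of its multiples. Hence, if among the terms of any sequence of monomials
some term divides a later one, a strategy of picking elements whose leading
term is not yet accounted for must stop, and submodules of the principal
projective are finitely generated ([groebner_noetherian]). Direct sums,
quotients and the Yoneda lemma extend this to all finitely generated modules
([noetherian_rep]).

So everything rests on orders for which divisibility is good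
([good_dominated]). Choose a root and a planar structure in each tree S, and
compare maps S -> T0 lexicographically along the depth-first order of the
vertices. A contraction f : S -> T0 is determined by the vertices at which one
enters its fibres when walking away from the root; marking the entry of the
fibre over v by v turns (S, f) into a planar tree whose labels are the vertices
of T0 and a blank. Suppose that phi is a label-preserving embedding of (T, f)
into (S, g), for the ancestor relations and the depth-first orders. It has a
retraction h : S -> T, sending s to the deepest t with phi t an ancestor of s,
characterised by: t is an ancestor of h s iff phi t is an ancestor of s
([anc_retract]). From this Galois connection and the labels one reads off
that h is a contraction, that f o h = g, that roots correspond, and, since phi t is the
first vertex of the fibre of h over t, that precomposition with h is strictly
increasing ([lexlt_retract]).

Nothing in this construction asks phi to preserve infima, so planar trees can
be encoded as binary trees (first child, next sibling) and embedded as such.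
Kruskal's theorem for these ([kruskal]) follows at once from the
minimal bad sequence argument.

Since h may be taken to preserve the roots, the argument applies to
rooted trees; a full subcategory of trees inherits it because h is a morphism
of any full subcategory that contains its source and target
([contractions_noetherian]). *)

Set Implicit Arguments.
Unset Strict Implicit.
Unset Printing Implicit Defensive.

(** * Good relations and minimal bad sequences *)

(** Goodness is the half of the notion of well-quasi-order that survives without
transitivity; Ramsey's theorem replaces transitivity below. *)
Definition good (X : Type) (R : X -> X -> Prop) : Prop :=
  forall f : nat -> X, exists i j, (i < j)%N /\ R (f i) (f j).

Definition bad (X : Type) (R : X -> X -> Prop) (f : nat -> X) : Prop :=
  forall i j, (i < j)%N -> ~ R (f i) (f j).

(** Dependent choice where the next term may depend on all previous ones. *)
Lemma history_choice (X : Type) (P : seq X -> X -> Prop) :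
  (forall s, exists x, P s x) ->
  exists f : nat -> X, forall n, P (mkseq f n) (f n).
Proof.
move=> /choice[g gP].
pose h := fix h n := if n is m.+1 then rcons (h m) (g (h m)) else [::].
exists (fun n => g (h n)) => n.
suff -> : mkseq (fun n => g (h n)) n = h n by [].
by elim: n => //= n IHn; rewrite mkseqS IHn.
Qed.

Lemma ex_min (P : nat -> Prop) :
  (exists n, P n) -> exists2 n, P n & forall m, P m -> (n <= m)%N.
Proof.
move=> exP; have exb : exists n, `[< P n >] by case: exP => n Pn; exists n; apply/asboolP.
case: (ex_minnP exb) => n /asboolP Pn nmin; exists n => // m Pm.
by apply: nmin; apply/asboolP.
Qed.

Lemma not_good_bad (X : Type) (R : X -> X -> Prop) (f : nat -> X) :
  ~ (exists i j, (i < j)%N /\ R (f i) (f j)) -> bad R f.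
Proof. by move=> nex i j ij Rij; apply: nex; exists i, j. Qed.

(** An instance of Ramsey's theorem for pairs. In any infinite set of
indices, some index is related to infinitely many later ones of the set:
otherwise one could greedily pick indices that are pairwise unrelated in
increasing order, against goodness. Choosing such an index in the set left by
the previous choice, again and again, gives the subsequence. *)
Lemma good_ascending (X : Type) (R : X -> X -> Prop) (f : nat -> X) : good R ->
  exists s : nat -> nat, forall i j, (i < j)%N ->
    (s i < s j)%N /\ R (f (s i)) (f (s j)).
Proof.
move=> gR; pose inf (I : nat -> Prop) := forall n, exists2 m, (n <= m)%N & I m.
have step I : inf I -> exists2 i, I i &
      inf (fun j => [/\ I j, (i < j)%N & R (f i) (f j)]).
  move=> infI; apply: contrapT => nex.
  have {nex} /choice[b bP] : forall i, exists n, I i -> forall m, (n <= m)%N -> I m ->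
      (i < m)%N -> ~ R (f i) (f m).
    move=> i; case: (pselect (I i)) => [Ii|nIi]; last by exists 0.
    apply: contrapT => nb; apply: nex; exists i => // n; apply: contrapT => nm.
    by apply: nb; exists n => _ m nlem Im im Rim; apply: nm; exists m.
  have [g gP] : exists g : nat -> nat, forall n,
      I (g n) /\ {in mkseq g n, forall i, (i < g n)%N && (b i <= g n)%N}.
    apply: (history_choice (P := fun s x =>
      I x /\ {in s, forall i, (i < x)%N && (b i <= x)%N})) => s.
    (* The sum bounds every i and every b i from above, for i in s. *)
    have [m sm Im] := infI (\sum_(i <- s) (i + b i).+1)%N; exists m; split=> // i si.
    have {sm} : ((i + b i).+1 <= m)%N.
      by apply: leq_trans sm; rewrite (big_rem _ si) /= leq_addr.
    move=> H; rewrite (leq_ltn_trans _ H) ?leq_addr //.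
    by rewrite (leq_trans _ (ltnW H)) ?leq_addl.
  have [i [j [ij Rij]]] := gR (f \o g).
  have [Igj /(_ (g i))] := gP j.
  rewrite map_f ?mem_iota // => /(_ isT)/andP[gij bgij].
  by apply: (bP (g i) (gP i).1 (g j)).
(* The indices that are still available after the choices s. *)
pose I (s : seq nat) j := {in s, forall i, (i < j)%N /\ R (f i) (f j)}.
have [g gP] : exists g : nat -> nat, forall n, inf (I (mkseq g n)) ->
    I (mkseq g n) (g n) /\ inf (I (mkseq g n.+1)).
  have [g gP] : exists g : nat -> nat, forall n, inf (I (mkseq g n)) ->
    I (mkseq g n) (g n) /\ inf (I (rcons (mkseq g n) (g n))).
    apply: (history_choice (P := fun s x =>
      inf (I s) -> I s x /\ inf (I (rcons s x)))) => s.
    case: (pselect (inf (I s))) => [infs|]; last by exists 0.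
    have [x Ix infx] := step _ infs; exists x => _; split=> // n.
    have [m nm [Im xm Rm]] := infx n; exists m => // i.
    by rewrite mem_rcons inE => /orP[/eqP ->|/Im].
  by exists g => n; rewrite mkseqS; apply: gP.
have infg n : inf (I (mkseq g n)).
  by elim: n => [|n /gP[]//]; move=> n; exists n.
exists g => i j ij; have [/(_ (g i)) + _] := gP _ (infg j).
by apply; rewrite map_f ?mem_iota.
Qed.

Lemma good_and (X : Type) (R R' : X -> X -> Prop) :
  good R -> good R' -> good (fun x y => R x y /\ R' x y).
Proof.
move=> gR gR' f; have [s sP] := good_ascending f gR.
have [i [j [ij R'ij]]] := gR' (f \o s).
by exists (s i), (s j); have [sij Rij] := sP _ _ ij.
Qed.

(** By the pigeonhole principle. *)
Lemma good_finite (L : finType) : good (@eq L).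
Proof.
move=> f; pose g (i : 'I_#|L|.+1) := f i.
have /injectivePn[i [j nij gij]] : ~~ injectiveb g.
  apply/injectiveP => /leq_card; rewrite card_ord ltnn //.
have [ij|ji|/val_inj ij] := ltngtP i j; last by rewrite ij eqxx in nij.
  by exists i, j.
by exists j, i.
Qed.

Definition minimal_bad (X : Type) (m : X -> nat) (R : X -> X -> Prop)
    (f : nat -> X) : Prop :=
  bad R f /\ forall n g, bad R g -> (forall i, (i < n)%N -> g i = f i) ->
    (m (f n) <= m (g n))%N.

(** Each term in turn is chosen of least size among the terms that continue the
choices made so far to a bad sequence. *)
Lemma exists_minimal_bad (X : Type) (m : X -> nat) (R : X -> X -> Prop) :
  ~ good R -> exists f, minimal_bad m R f.
Proof.
move=> ngood.
pose ext s g := bad R g /\ mkseq g (size s) = s.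
have [f fP] : exists f : nat -> X, forall n, (exists g, ext (mkseq f n) g) ->
    (exists g, ext (mkseq f n.+1) g) /\
    forall g, ext (mkseq f n) g -> (m (f n) <= m (g n))%N.
  have [|f fP] := @history_choice X (fun s x => (exists g, ext s g) ->
    (exists g, ext (rcons s x) g) /\ forall g, ext s g -> (m x <= m (g (size s)))%N);
    last by exists f => n; have := fP n; rewrite mkseqS size_mkseq.
  move=> s; case: (pselect (exists g, ext s g)) => [exg|].
    have [|n [g gs <-] nmin] := @ex_min
      (fun n => exists2 g, ext s g & m (g (size s)) = n).
      by case: exg => g gs; exists (m (g (size s))), g.
    exists (g (size s)) => _; split; last by move=> g' g's; apply: nmin; exists g'.
    by exists g; split; [exact: gs.1 | rewrite size_rcons mkseqS gs.2].
  have [f0 _] : exists f0 : nat -> X, True.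
    by apply: contrapT => nf; apply: ngood => f; case: nf; exists f.
  by exists (f0 0).
have extf n : exists g, ext (mkseq f n) g.
  elim: n => [|n /fP[]//]; apply: contrapT => ng; apply: ngood => f0.
  by apply: contrapT => /not_good_bad bf0; apply: ng; exists f0; split.
have eqf n g i : ext (mkseq f n) g -> (i < n)%N -> g i = f i.
  move=> [_]; rewrite size_mkseq => /(congr1 (nth (g i) ^~ i)) + lt_in.
  by rewrite !nth_mkseq.
exists f; split=> [i j ij|n g badg geq].
  have [g gP] := extf j.+1; rewrite -(eqf _ _ _ gP (leqW ij)) -(eqf _ _ _ gP (leqnn _)).
  exact: gP.1.
apply: (fP _ (extf n)).2; split=> //; rewrite size_mkseq.
apply: (@eq_from_nth _ (f 0)); rewrite ?size_mkseq // => i lt_in.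
by rewrite !nth_mkseq // geq.
Qed.

(** The Nash-Williams argument. A bad sequence of terms y (n i) could be spliced
in after the terms of f that precede the least of the indices n i. The result
would still be bad, since being above y (n i) forces being above f (n i), and
would beat f at that least index. *)
Lemma minimal_bad_below (X : Type) (m : X -> nat) (R : X -> X -> Prop) f
    (y : nat -> X) : minimal_bad m R f ->
  (forall i, (m (y i) < m (f i))%N) ->
  (forall i z, R z (y i) -> R z (f i)) ->
  good (fun i j => R (y i) (y j)).
Proof.
move=> [badf minf] my Ry n; apply: contrapT => /not_good_bad badyn.
have [|_ [i0 <-] nmin] := @ex_min (fun k => exists i, n i = k).
  by exists (n 0), 0.
pose g k := if (k < n i0)%N then f k else y (n (i0 + (k - n i0))%N).
have gn : g (n i0) = y (n i0) by rewrite /g ltnn subnn addn0.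
suff: (m (f (n i0)) <= m (g (n i0)))%N by rewrite gn leqNgt my.
apply: minf => [i j ij|i ltin]; last by rewrite /g ltin.
rewrite /g; case: ltnP => ni; case: ltnP => nj.
- exact: badf.
- move=> /Ry; apply: badf; apply: leq_trans ni (nmin _ _).
  by eexists.
- by move: (ltn_trans (leq_ltn_trans ni ij) nj); rewrite ltnn.
- by apply: badyn; rewrite ltn_add2l ltn_sub2rE.
Qed.

(** * Kruskal's theorem for planar forests *)

(** First child and next sibling encoding: [Cons a c s] has a first tree with
root a and children c, followed by the forest s. *)
Inductive forest (A : Type) := Nil | Cons of A & forest A & forest A.
Arguments Nil {A}.

(** A whole forest may be embedded below a single vertex: infima need not be
preserved, which is why the relation can be defined by recursion on the binary
encoding. *)
Inductive embeds (A B : Type) (R : A -> B -> Prop) : forest A -> forest B -> Prop :=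
| emb_nil G : embeds R Nil G
| emb_child F b d s : embeds R F d -> embeds R F (Cons b d s)
| emb_sibling F b d s : embeds R F s -> embeds R F (Cons b d s)
| emb_node a c s b d s' : R a b -> embeds R c d -> embeds R s s' ->
    embeds R (Cons a c s) (Cons b d s').

(** The vertices in depth-first order: a vertex comes before its descendants. *)
Fixpoint flat (A : Type) (F : forest A) : seq A :=
  if F is Cons a c s then a :: flat c ++ flat s else [::].

(** In a minimal bad sequence of forests the forests of children form a good
family, and so do the forests of siblings; the roots do by hypothesis. A pair
of indices that is good for all three at once contradicts badness. *)
Theorem kruskal (A : Type) (R : A -> A -> Prop) : good R -> good (embeds R).
Proof.
move=> gR; apply: contrapT.
move=> /(@exists_minimal_bad _ (size \o @flat A))[f fmin].
have /choice[acs fE] : forall i, exists acs, f i = Cons acs.1 acs.2.1 acs.2.2.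
  move=> i; case fi: (f i) => [|a c s]; last by exists (a, (c, s)).
  by have := fmin.1 i i.+1 (leqnn _); rewrite fi; case; apply: emb_nil.
have gc : good (fun i j => embeds R (acs i).2.1 (acs j).2.1).
  apply: (minimal_bad_below fmin) => [i|i z]; rewrite fE /=.
    by rewrite ltnS size_cat leq_addr.
  exact: emb_child.
have gs : good (fun i j => embeds R (acs i).2.2 (acs j).2.2).
  apply: (minimal_bad_below fmin) => [i|i z]; rewrite fE /=.
    by rewrite ltnS size_cat leq_addl.
  exact: emb_sibling.
have ga : good (fun i j => R (acs i).1 (acs j).1).
  by move=> n; apply: (gR (fun i => (acs (n i)).1)).
have [i [j [ij [Ra [Rc Rs]]]]] := good_and ga (good_and gc gs) id.
by apply: (fmin.1 i j ij); rewrite !fE; apply: emb_node.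
Qed.

(** * The ancestor relation of a planar forest *)

Section Forests.
Variable V : eqType.
Implicit Types (F G : forest V) (x y z : V).

Fixpoint roots F : seq V := if F is Cons a _ s then a :: roots s else [::].

Fixpoint anc F x y : bool :=
  if F is Cons a c s then
    [|| (x == a) && (y \in a :: flat c), anc c x y | anc s x y]
  else false.

Fixpoint edge F x y : bool :=
  if F is Cons a c s then
    [|| (x == a) && (y \in roots c), edge c x y | edge s x y]
  else false.

Lemma roots_flat F : {subset roots F <= flat F}.
Proof.
elim: F => //= a c _ s IHs x; rewrite !inE mem_cat.
by case/orP=> [->//|/IHs ->]; rewrite !orbT.
Qed.

Lemma anc_mem F x y : anc F x y -> x \in flat F /\ y \in flat F.
Proof.
elim: F => //= a c IHc s IHs; rewrite !inE !mem_cat.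
case/or3P=> [/andP[-> /orP[->|->]]|/IHc[-> ->]|/IHs[-> ->]]; rewrite ?orbT //.
Qed.

Lemma edge_mem F x y : edge F x y -> x \in flat F /\ y \in flat F.
Proof.
elim: F => //= a c IHc s IHs; rewrite !inE !mem_cat.
case/or3P=> [/andP[-> /roots_flat->]|/IHc[-> ->]|/IHs[-> ->]]; rewrite ?orbT //.
Qed.

Lemma anc_refl F x : x \in flat F -> anc F x x.
Proof.
elim: F => //= a c IHc s IHs; rewrite !inE mem_cat.
by case: eqP => //= _ /orP[/IHc ->|/IHs ->]; rewrite ?orbT.
Qed.

Lemma uniq_Cons a (c s : forest V) : uniq (flat (Cons a c s)) ->
  [/\ uniq (flat c), uniq (flat s), a \notin flat c, a \notin flat s &
    forall x, x \in flat c -> x \in flat s -> false].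
Proof.
rewrite /= mem_cat negb_or cat_uniq => /andP[/andP[-> ->] /and3P[-> /hasPn H ->]].
by split=> // x xc /H /=; rewrite xc.
Qed.

Lemma anc_index F x y : uniq (flat F) -> anc F x y ->
  (index x (flat F) <= index y (flat F))%N.
Proof.
elim: F x y => // a c IHc s IHs x y /uniq_Cons[uc us ac as_ cs].
rewrite [anc _ _ _]/= [flat _]/=.
case/or3P=> [/andP[/eqP -> _]|/[dup]/anc_mem[xc yc]/(IHc _ _ uc)
            |/[dup]/anc_mem[xs ys]/(IHs _ _ us)].
- by rewrite /= eqxx.
- have ax : (a == x) = false by apply/eqP => E; rewrite E xc in ac.
  have ay : (a == y) = false by apply/eqP => E; rewrite E yc in ac.
  by rewrite /= ax ay !index_cat xc yc ltnS.
- have ax : (a == x) = false by apply/eqP => E; rewrite E xs in as_.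
  have ay : (a == y) = false by apply/eqP => E; rewrite E ys in as_.
  have xc : x \in flat c = false by apply/negP => /cs/(_ xs).
  have yc : y \in flat c = false by apply/negP => /cs/(_ ys).
  by rewrite /= ax ay !index_cat xc yc ltnS leq_add2l.
Qed.

Lemma anc_antisym F x y : uniq (flat F) -> anc F x y -> anc F y x -> x = y.
Proof.
move=> uF xy yx; have [xF yF] := anc_mem xy.
apply: (index_inj x xF yF).
by apply/eqP; rewrite eqn_leq !anc_index.
Qed.

Lemma anc_Cons_root a (c s : forest V) y : uniq (flat (Cons a c s)) ->
  anc (Cons a c s) a y = (y \in a :: flat c).
Proof.
case/uniq_Cons=> _ _ ac as_ _; rewrite /= eqxx /=.
case E: (anc c a y); first by rewrite (anc_mem E).1 in ac.
by case E': (anc s a y); [rewrite (anc_mem E').1 in as_ | rewrite !orbF].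
Qed.

Lemma anc_Cons_child a (c s : forest V) x y : uniq (flat (Cons a c s)) ->
  x \in flat c -> anc (Cons a c s) x y = anc c x y.
Proof.
case/uniq_Cons=> _ _ ac as_ cs xc /=; have -> : (x == a) = false.
  by apply/eqP => E; rewrite -E xc in ac.
by case E: (anc s x y); [case: (cs x xc (anc_mem E).1) | rewrite orbF].
Qed.

Lemma anc_Cons_sibling a (c s : forest V) x y : uniq (flat (Cons a c s)) ->
  x \in flat s -> anc (Cons a c s) x y = anc s x y.
Proof.
case/uniq_Cons=> _ _ ac as_ cs xs /=; have -> : (x == a) = false.
  by apply/eqP => E; rewrite -E xs in as_.
by case E: (anc c x y); [case: (cs x (anc_mem E).1 xs) | ].
Qed.

Lemma anc_trans F x y z : uniq (flat F) -> anc F x y -> anc F y z -> anc F x z.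
Proof.
elim: F => // a c IHc s IHs uF; have [uc us ac as_ cs] := uniq_Cons uF.
move=> /[dup]/anc_mem[+ _]; rewrite [flat _]/= inE mem_cat => /or3P[/eqP ->|xc|xs].
- rewrite !anc_Cons_root // inE => /orP[/eqP ->|yc].
    by rewrite anc_Cons_root.
  by rewrite anc_Cons_child // inE => /anc_mem[_ ->]; rewrite orbT.
- rewrite !(anc_Cons_child _ _ xc) // => xy.
  by rewrite anc_Cons_child ?(anc_mem xy).2 // => /(IHc uc xy).
- rewrite !(anc_Cons_sibling _ _ xs) // => xy.
  by rewrite anc_Cons_sibling ?(anc_mem xy).2 // => /(IHs us xy).
Qed.

Lemma anc_roots F x z : uniq (flat F) -> x \in roots F -> anc F z x = (z == x).
Proof.
move=> uF xF; apply/idP/eqP => [|->]; last by rewrite anc_refl ?roots_flat.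
elim: F uF xF => // a c _ s IHs uF; have [uc us ac as_ cs] := uniq_Cons uF.
rewrite inE => /orP[/eqP -> zx|xs].
  have /eqP az := anc_index uF zx.
  by move: az; rewrite /= eqxx; case: eqP.
move=> /= /or3P[/andP[_]|/anc_mem[_ xc]|]; last exact: IHs.
  rewrite inE => /orP[/eqP E|xc]; first by rewrite -E roots_flat in as_.
  by case: (cs _ xc (roots_flat xs)).
by case: (cs _ xc (roots_flat xs)).
Qed.

Lemma parent_exists F x : x \in flat F -> x \notin roots F -> exists p, edge F p x.
Proof.
elim: F => //= a c IHc s IHs; rewrite !inE mem_cat negb_or.
move=> /or3P[->|xc|xs] //= /andP[_ xs']; last first.
  by have [p ps] := IHs xs xs'; exists p; rewrite ps !orbT.
have [xr|/(IHc xc)[p pc]] := boolP (x \in roots c).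
  by exists a; rewrite eqxx.
by exists p; rewrite pc orbT.
Qed.

(** This equation characterises the parent of x, and is how edges enter all later
arguments. *)
Lemma anc_edge F p x z : uniq (flat F) -> edge F p x ->
  anc F z p = anc F z x && (z != x).
Proof.
elim: F => // a c IHc s IHs uF; have [uc us ac as_ cs] := uniq_Cons uF.
move=> /= /or3P[/andP[/eqP -> xr]|px|px].
- have xc := roots_flat xr; have xa : (x == a) = false.
    by apply/eqP => E; rewrite -E xc in ac.
  rewrite !inE eqxx xa xc /= andbT.
  case: (eqVneq z a) => [->|za] /=; first by rewrite eq_sym xa.
  case E: (anc c z a); first by rewrite (anc_mem E).2 in ac.
  case E': (anc s z a); first by rewrite (anc_mem E').2 in as_.
  rewrite anc_roots //; case E'': (anc s z x); last by case: eqP.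
  by case: (cs _ xc (anc_mem E'').2).
- have [pc xc] := edge_mem px.
  have xa : (x == a) = false by apply/eqP => E; rewrite -E xc in ac.
  have pa : (p == a) = false by apply/eqP => E; rewrite -E pc in ac.
  rewrite !inE xa pa xc pc /= andbT IHc //.
  have nanc y : y \in flat c -> anc s z y = false.
    by move=> yc; apply/negP => /anc_mem[_ /(cs _ yc)].
  rewrite !nanc // !orbF.
  by case: (eqVneq z a) => //= ->; rewrite eq_sym xa.
- have [ps xs] := edge_mem px.
  have xa : (x == a) = false by apply/eqP => E; rewrite -E xs in as_.
  have pa : (p == a) = false by apply/eqP => E; rewrite -E ps in as_.
  have nc y : y \in flat s -> y \in flat c = false.
    by move=> ys; apply/negP => /cs/(_ ys).
  have nanc y : y \in flat s -> anc c z y = false.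
    by move=> /nc yc; apply/negP => /anc_mem[_]; rewrite yc.
  by rewrite !inE xa pa !nc // !nanc //= !andbF IHs.
Qed.

Fixpoint graft (a b : V) F : forest V :=
  if F is Cons x c s then
    Cons x (if x == a then Cons b Nil (graft a b c) else graft a b c) (graft a b s)
  else Nil.

Lemma count_graft a b F P : count P (flat (graft a b F)) =
  (count P (flat F) + P b * count_mem a (flat F))%N.
Proof.
elim: F => [|x c IHc s IHs]; first by rewrite muln0.
rewrite /= !count_cat IHs; have -> : count P (flat (if x == a
    then Cons b Nil (graft a b c) else graft a b c)) =
  (P b * (x == a) + count P (flat (graft a b c)))%N.
  by case: eqP => _; rewrite ?muln1 // muln0.
by rewrite IHc !mulnDr; lia.
Qed.

Lemma graft_perm a b F : uniq (flat F) -> a \in flat F ->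
  perm_eq (flat (graft a b F)) (b :: flat F).
Proof.
move=> uF aF; apply/permP => P; rewrite count_graft (count_uniq_mem _ uF) aF muln1 /=.
by rewrite addnC.
Qed.

Lemma roots_graft a b F : roots (graft a b F) = roots F.
Proof. by elim: F => //= x c _ s ->. Qed.

Lemma edge_graft a b F x y : edge (graft a b F) x y ->
  edge F x y \/ x = a /\ y = b.
Proof.
elim: F => //= v c IHc s IHs /or3P[/andP[/eqP ->]|+|/IHs[->|]].
- case: eqP => [->|_] /=; rewrite ?inE roots_graft ?eqxx.
    by case/orP=> [/eqP|] ->; [right | left].
  by move=> ->; left.
- by case: eqP => _ /=; rewrite ?in_nil ?andbF /= => /IHc[->|E];
    [left; rewrite ?orbT | right | left; rewrite ?orbT | right].
- by left; rewrite !orbT.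
- by right.
Qed.

End Forests.

(** * Embeddings of labelled forests as maps of vertices *)

Fixpoint fmap (A B : Type) (f : A -> B) (F : forest A) : forest B :=
  if F is Cons a c s then Cons (f a) (fmap f c) (fmap f s) else Nil.

Lemma emb_fmap (A B C : Type) (R : C -> C -> Prop) (f : A -> C) (g : B -> C) F G :
  embeds R (fmap f F) (fmap g G) -> embeds (fun a b => R (f a) (g b)) F G.
Proof.
elim: G F => [|b d IHd s' IHs] [|a c s] H; try exact: emb_nil.
  by inversion H.
inversion H; subst.
- exact/emb_child/IHd.
- exact/emb_sibling/IHs.
- by apply: emb_node; [|exact: IHd|exact: IHs].
Qed.

(** The map phi is glued from the maps for children and siblings. That it sends
the depth-first order to a subsequence of the depth-first order says at once
that it is injective and increasing. The default map phi0 only supplies values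
away from F. *)
Lemma emb_order (V W : eqType) (R : V -> W -> Prop) (phi0 : V -> W) F G :
  embeds R F G -> uniq (flat F) -> uniq (flat G) -> exists phi : V -> W,
  [/\ subseq (map phi (flat F)) (flat G),
      {in flat F, forall x, R x (phi x)}
    & {in flat F &, forall x y, anc G (phi x) (phi y) = anc F x y}].
Proof.
elim=> {F G} [G|F b d s _ IH uF|F b d s _ IH uF|a c s b d s' Rab _ IHc _ IHs].
- by exists phi0; split=> //; rewrite sub0seq.
- move=> uG; have [ud us bd bs ds] := uniq_Cons uG.
  have [phi [sub Rphi ancphi]] := IH uF ud; exists phi; split=> //.
    exact: subseq_trans (subseq_trans sub (prefix_subseq _ (flat s))) (subseq_cons _ b).
  move=> x y xF yF; rewrite anc_Cons_child ?ancphi //.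
  by apply: (mem_subseq sub); rewrite map_f.
- move=> uG; have [ud us bd bs ds] := uniq_Cons uG.
  have [phi [sub Rphi ancphi]] := IH uF us; exists phi; split=> //.
    exact: subseq_trans (subseq_trans sub (suffix_subseq (flat d) _)) (subseq_cons _ b).
  move=> x y xF yF; rewrite anc_Cons_sibling ?ancphi //.
  by apply: (mem_subseq sub); rewrite map_f.
move=> uF uG; have [uc us ac as_ cs] := uniq_Cons uF.
have [ud us' bd bs' ds'] := uniq_Cons uG.
have [phic [subc Rc ancc]] := IHc uc ud; have [phis [subs Rs ancs]] := IHs us us'.
pose phi x := if x == a then b else if x \in flat c then phic x else phis x.
have phia : phi a = b by rewrite /phi eqxx.
have phicE : {in flat c, phi =1 phic}.
  move=> x xc; rewrite /phi xc; case: eqP => // E.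
  by rewrite -E xc in ac.
have phisE : {in flat s, phi =1 phis}.
  move=> x xs; rewrite /phi; case: eqP => E; first by rewrite -E xs in as_.
  by case: ifP => // xc; case: (cs x xc xs).
have memc x : x \in flat c -> phi x \in flat d.
  by move=> xc; rewrite phicE //; apply: (mem_subseq subc); rewrite map_f.
have mems x : x \in flat s -> phi x \in flat s'.
  by move=> xs; rewrite phisE //; apply: (mem_subseq subs); rewrite map_f.
exists phi; split.
- rewrite /= phia eqxx map_cat.
  have /eq_in_map -> := phicE; have /eq_in_map -> := phisE.
  exact: cat_subseq.
- move=> x; rewrite inE mem_cat => /or3P[/eqP ->|xc|xs]; first by rewrite phia.
    by rewrite phicE //; apply: Rc.
  by rewrite phisE //; apply: Rs.
move=> x y; rewrite inE mem_cat => /or3P[/eqP ->|xc|xs]; rewrite inE mem_cat.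
- rewrite phia !anc_Cons_root // !inE.
  case/or3P=> [/eqP ->|yc|ys]; first by rewrite phia !eqxx.
    by rewrite yc memc ?orbT.
  have -> : (y == a) = false by apply/eqP => E; rewrite -E ys in as_.
  have -> : (phi y == b) = false by apply/eqP => E; rewrite -E mems in bs'.
  have -> : (y \in flat c) = false by apply/negP => /cs/(_ ys).
  by apply/negP => /ds'/(_ (mems _ ys)).
- rewrite !anc_Cons_child ?memc //.
  case/or3P=> [/eqP ->|yc|ys].
  + rewrite phia; apply/idP/idP => /anc_mem[_]; first by rewrite (negPf bd).
    by rewrite (negPf ac).
  + by rewrite !phicE // ancc.
  + by apply/idP/idP => /anc_mem[_]; [move/ds'/(_ (mems _ ys))|move/cs/(_ ys)].
- rewrite !anc_Cons_sibling ?mems //.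
  case/or3P=> [/eqP ->|yc|ys].
  + rewrite phia; apply/idP/idP => /anc_mem[_]; first by rewrite (negPf bs').
    by rewrite (negPf as_).
  + by apply/idP/idP => /anc_mem[_]; [move/(ds' _ (memc _ yc))|move/(cs _ yc)].
  + by rewrite !phisE // ancs.
Qed.

Lemma subseq_index (T : eqType) (s1 s2 : seq T) x y :
  subseq s1 s2 -> uniq s2 -> x \in s1 -> y \in s1 ->
  (index x s2 < index y s2)%N = (index x s1 < index y s1)%N.
Proof.
move=> sub u2; have u1 := subseq_uniq sub u2.
suff H a b : a \in s1 -> b \in s1 -> (index a s1 < index b s1)%N ->
    (index a s2 < index b s2)%N.
  move=> x1 y1; apply/idP/idP; last exact: H.
  apply: contraLR; rewrite -!leqNgt leq_eqVlt => /orP[/eqP E|/H].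
    2: by move/(_ y1 x1)/ltnW.
  by rewrite (index_inj x y1 x1 E).
move=> a1 b1 ab.
have : pairwise (fun u v => (index u s2 < index v s2)%N) s1.
  apply: (subseq_pairwise sub); apply/(pairwiseP x) => i j; rewrite !inE => ilt jlt ij.
  by rewrite !index_uniq.
move/(pairwiseP x)/(_ (index a s1) (index b s1)).
by rewrite !nth_index // !inE !index_mem; apply.
Qed.

(** * Planar layouts of rooted trees *)

(** A path in e from x to y of length at least two would close up to a cycle with
the edge between x and y. So the edges of a spanning tree of T are all the
edges of T. *)
Lemma acyclic_connect (T : tree) (e : rel T) x y :
  (forall a b, e a b -> adj a b) -> connect e x y -> adj x y -> e x y.
Proof.
move=> e_adj /connectP[p0 ep0 def_y] xy.
case/shortenP: ep0 def_y => p ep up _ def_y {p0}.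
case: p ep up def_y => [|b [|c p]] ep up def_y.
- by rewrite def_y /= adj_irr in xy.
- by rewrite def_y; move: ep; rewrite /= andbT.
have /(@tree_acyclic T) // : ucycle adj (x :: b :: c :: p).
rewrite /ucycle up andbT /cycle rcons_path (sub_path e_adj ep) /=.
by rewrite -[last c p]/(last x [:: b, c & p]) -def_y adj_sym.
Qed.

(** A planar structure on the tree T with root r. *)
Definition layout (T : tree) (r : T) (F : forest T) : Prop :=
  [/\ roots F = [:: r], uniq (flat F), forall x, x \in flat F
    & forall x y, adj x y = edge F x y || edge F y x].

(** As long as some vertex is missing, connectedness provides an edge that leaves
the forest, along which a new leaf is grafted. *)
Lemma exists_spanning (T : tree) (r : T) n : (n < #|T|)%N ->
  exists c, let F := Cons r c Nil in
  [/\ uniq (flat F), size (flat F) = n.+1 & forall x y, edge F x y -> adj x y].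
Proof.
elim: n => [_|n IHn ltn].
  by exists Nil; split=> // x y; rewrite /= andbF.
have [c [uF sizeF edgeF]] := IHn (ltnW ltn); set F := Cons r c Nil in uF sizeF edgeF.
have [a [b [aF bF ab]]] : exists a b, [/\ a \in flat F, b \notin flat F & adj a b].
  apply: contrapT => nab.
  have cl : closed adj (mem (flat F)).
    move=> a b ab; apply/idP/idP => [aF|bF]; apply/negPn/negP => nF; apply: nab.
      by exists a, b.
    by exists b, a; rewrite adj_sym.
  have allF x : x \in flat F.
    case/andP: (tree_connected T) => _ /forallP/(_ r)/forallP/(_ x).
    by move=> /(closed_connect cl) <-; apply: mem_head.
  move: ltn; rewrite -sizeF -(card_uniqP uF) ltnNge.
  by rewrite (_ : #|T| <= _)%N // subset_leq_card //; apply/subsetP => x _; apply: allF.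
exists (if r == a then Cons b Nil (graft a b c) else graft a b c).
rewrite [Cons r _ _](_ : _ = graft a b F) //; have perm_graft := graft_perm b uF aF.
split=> [||x y].
- by rewrite (perm_uniq perm_graft) /= bF.
- by rewrite (perm_size perm_graft) /= -[X in _ = X.+1]sizeF.
- by case/edge_graft=> [/edgeF|[-> ->]].
Qed.

(** A spanning planar tree of T already has all the edges of T. *)
Lemma exists_layout (T : tree) (r : T) : exists F, layout r F.
Proof.
have T0 : (0 < #|T|)%N by case/andP: (tree_connected T).
have [|c] := @exists_spanning T r #|T|.-1; first by rewrite prednK.
set F := Cons r c Nil => -[uF sizeF edgeF]; exists F.
have /subset_cardP/(_ (subset_predT _)) flatT : #|flat F| = #|T|.
  by rewrite (card_uniqP uF) sizeF prednK.
have allF x : x \in flat F by rewrite flatT.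
have ancF x : connect (fun u v => edge F u v || edge F v u) r x.
  have [n] := ubnP (index x (flat F)); elim: n x => // n IHn x; rewrite ltnS => ltn.
  have [|nxr] := boolP (x \in roots F).
    by rewrite /= inE => /eqP ->; apply: connect0.
  have [p px] := parent_exists (allF x) nxr.
  have pxa := anc_edge p uF px; rewrite anc_refl // in pxa.
  case/esym/andP: pxa => pxa np.
  apply: connect_trans (IHn p _) (connect1 _); last by rewrite px.
  apply: leq_trans ltn; rewrite ltn_neqAle anc_index // andbT.
  by apply: contraNneq np => /(index_inj r (allF p) (allF x)) ->.
split=> // x y; apply/idP/orP => [xy|[/edgeF//|/edgeF]]; last by rewrite adj_sym.
apply/orP; apply: (acyclic_connect
  (e := fun u v => edge F u v || edge F v u)) => // [a b|].
  by case/orP=> /edgeF //; rewrite adj_sym.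
suff symc : connect_sym (fun u v => edge F u v || edge F v u).
  by apply: connect_trans (ancF y); rewrite symc; apply: ancF.
by apply: sym_connect_sym => a b; rewrite orbC.
Qed.

Section Layout.
Variables (T : tree) (r : T) (F : forest T).
Hypothesis lF : layout r F.
Let uF : uniq (flat F). Proof. by case: lF. Qed.
Let allF x : x \in flat F. Proof. by case: lF. Qed.

Definition parent (x : T) : T := odflt x [pick p | edge F p x].

Lemma edge_parent p x : edge F p x -> parent x = p.
Proof.
rewrite /parent; case: pickP => [q qx px|->] //=.
by apply: (anc_antisym uF); [rewrite (anc_edge _ uF px) -(anc_edge _ uF qx) |
  rewrite (anc_edge _ uF qx) -(anc_edge _ uF px)]; apply: anc_refl.
Qed.

Lemma parent_edge x : x != r -> edge F (parent x) x.
Proof.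
move=> xr; have [|p px] := parent_exists (allF x).
  by case: lF => -> _ _ _; rewrite inE.
by rewrite (edge_parent px).
Qed.

Lemma anc_parent x z : x != r -> anc F z (parent x) = anc F z x && (z != x).
Proof. by move=> /parent_edge/(anc_edge z uF). Qed.

Lemma parent_anc x : x != r -> anc F (parent x) x.
Proof.
by move=> xr; have := anc_parent (parent x) xr; rewrite anc_refl // => /esym/andP[].
Qed.

Lemma parent_neq x : x != r -> parent x != x.
Proof.
by move=> xr; have := anc_parent (parent x) xr; rewrite anc_refl // => /esym/andP[].
Qed.

Lemma index_parent x : x != r -> (index (parent x) (flat F) < index x (flat F))%N.
Proof.
move=> xr; rewrite ltn_neqAle anc_index ?parent_anc // andbT.
by apply: contraNneq (parent_neq xr) => /(index_inj r (allF _) (allF _)) ->.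
Qed.

Lemma layout_ind (P : T -> Prop) :
  P r -> (forall x, x != r -> P (parent x) -> P x) -> forall x, P x.
Proof.
move=> Pr Ppar x; have [n] := ubnP (index x (flat F)).
elim: n x => // n IHn x; rewrite ltnS => ltn.
have [->//|xr] := eqVneq x r; apply: Ppar => //; apply: IHn.
exact: leq_trans (index_parent xr) ltn.
Qed.

Lemma anc_root x : anc F r x.
Proof.
elim/layout_ind: x => [|x xr IHx]; first exact: anc_refl.
exact: anc_trans IHx (parent_anc xr).
Qed.

Lemma anc_chain x y z : anc F x z -> anc F y z -> anc F x y || anc F y x.
Proof.
elim/layout_ind: z => [|z zr IHz] xz yz.
  have -> : x = r by apply: (anc_antisym uF) => //; apply: anc_root.
  by rewrite anc_root.
have [E|xz'] := eqVneq x z; first by rewrite E yz orbT.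
have [E|yz'] := eqVneq y z; first by rewrite E xz.
by apply: IHz; rewrite anc_parent // ?xz ?yz.
Qed.

Lemma edge_nroot p x : edge F p x -> x != r.
Proof.
move=> px; apply/eqP => E; have := anc_edge r uF px.
by rewrite anc_root E eqxx andbF.
Qed.

Lemma adj_parent x y : adj x y -> x != r /\ y = parent x \/ y != r /\ x = parent y.
Proof.
case: lF => _ _ _ -> /orP[] E; [right|left]; by rewrite (edge_parent E) (edge_nroot E).
Qed.

Lemma parent_adj x : x != r -> adj (parent x) x.
Proof. by case: lF => _ _ _ -> /parent_edge ->. Qed.

End Layout.

(** * The retraction of an embedding *)

Section Retraction.
Variables (T S : tree) (rT : T) (rS : S) (F : forest T) (G : forest S).
Hypotheses (lT : layout rT F) (lS : layout rS G).
Variable phi : T -> S.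
Hypothesis anc_phi : forall x y, anc G (phi x) (phi y) = anc F x y.
Hypothesis phi_root : phi rT = rS.

(** The deepest vertex t with phi t above s. Such t form a chain, along which
depth-first positions increase, so that the last position finds the deepest. *)
Definition retract (s : S) : T := [arg max_(t > rT | anc G (phi t) s) index t (flat F)].

Let uF : uniq (flat F). Proof. by case: lT. Qed.
Let uG : uniq (flat G). Proof. by case: lS. Qed.
Let allF x : x \in flat F. Proof. by case: lT. Qed.
Let allG x : x \in flat G. Proof. by case: lS. Qed.

(** The map retract is right adjoint to phi; everything else about retract follows
from this equation. *)
Lemma anc_retract t s : anc F t (retract s) = anc G (phi t) s.
Proof.
rewrite /retract; case: arg_maxnP => [|u us umax].
  by rewrite phi_root (anc_root lS).
apply/idP/idP => [tu|ts]; first by apply: (anc_trans uG) us; rewrite anc_phi.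
have := anc_chain lS ts us; rewrite !anc_phi => /orP[//|ut].
rewrite (_ : t = u) ?anc_refl //; apply: (index_inj t (allF t) (allF u)).
by apply/eqP; rewrite eqn_leq [_ <= _](umax _ ts) anc_index.
Qed.

Lemma anc_ext x y : (forall z, anc F z x = anc F z y) -> x = y.
Proof.
by move=> E; apply: (anc_antisym uF); [rewrite -E | rewrite E]; apply: anc_refl.
Qed.

Lemma retract_phi t : retract (phi t) = t.
Proof. by apply: anc_ext => z; rewrite anc_retract anc_phi. Qed.

Lemma phi_inj : injective phi.
Proof. exact: can_inj retract_phi. Qed.

(** Only a vertex in the image of phi distinguishes its ancestors from those of
its parent. *)
Lemma retract_parent s : s != rS -> (forall t, phi t != s) ->
  retract (parent G s) = retract s.
Proof.
move=> sr ns; apply: anc_ext => z.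
by rewrite !anc_retract (anc_parent lS) // ns andbT.
Qed.

Lemma retract_parent_phi t : t != rT -> retract (parent G (phi t)) = parent F t.
Proof.
move=> tr; apply: anc_ext => z; rewrite anc_retract (anc_parent lT) //.
by rewrite (anc_parent lS) -?phi_root ?(inj_eq phi_inj) // anc_phi.
Qed.

(** An edge of S from a parent to s is collapsed when s is outside the image of
phi, and is sent to the edge above t when s = phi t. Fibres are connected
because from each vertex of the fibre over z one can climb to phi z inside the
fibre. *)
Lemma retract_contraction : contractionb (finfun retract).
Proof.
apply/andP; split.
  have Hp s : s != rS -> retract (parent G s) = retract s \/
      adj (retract (parent G s)) (retract s).
    move=> sr; case: (pickP (fun t => phi t == s)) => [t /eqP E|ns].
      move: sr; rewrite -E -phi_root (inj_eq phi_inj) => tr.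
      by rewrite retract_parent_phi // retract_phi; right; apply: (parent_adj lT).
    by left; apply: retract_parent => // t; rewrite ns.
  apply/forallP=> x; apply/forallP=> y; apply/implyP => xy; rewrite !ffunE.
  case: (adj_parent lS xy) => [[/Hp + ->]|[/Hp + ->]].
    by case=> [->|]; rewrite ?eqxx // adj_sym => ->; rewrite orbT.
  by case=> [->|->]; rewrite ?eqxx ?orbT.
apply/forallP => z.
have zin : phi z \in finfun retract @^-1: [set z] by rewrite !inE ffunE retract_phi.
apply/andP; split; first by apply/card_gt0P; exists (Sub (phi z) zin).
set e := induced _ _.
have symc : connect_sym e by apply: sym_connect_sym => x y; rewrite /e /induced adj_sym.
have to_top s : forall sz : s \in finfun retract @^-1: [set z],
    connect e (Sub s sz) (Sub (phi z) zin).
  elim/(layout_ind lS): s => [sz|s sr IHs sz].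
    rewrite (_ : Sub _ _ = Sub (phi z) zin) ?connect0 //; apply: val_inj => /=.
    by move: sz; rewrite !inE ffunE -phi_root retract_phi => /eqP ->.
  have rsz : retract s = z by move: sz; rewrite !inE ffunE => /eqP.
  case: (pickP (fun t => phi t == s)) => [t /eqP E|ns].
    rewrite (_ : Sub _ _ = Sub (phi z) zin) ?connect0 //; apply: val_inj => /=.
    by rewrite -rsz -E retract_phi.
  have psz : parent G s \in finfun retract @^-1: [set z].
    by rewrite !inE ffunE retract_parent ?rsz // => t; rewrite ns.
  apply: connect_trans (IHs psz); apply: connect1.
  by rewrite /e /induced /= adj_sym (parent_adj lS).
apply/forallP => -[x xz]; apply/forallP => -[y yz].
by apply: (connect_trans (to_top x xz)); rewrite symc; apply: to_top.
Qed.

End Retraction.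

(** * Contractions as labellings *)

(** Some (g x) marks the vertices at which a walk from the root enters a fibre
of g. *)
Definition entry_label (S : tree) (W : eqType) (r : S) (G : forest S)
    (g : S -> W) (x : S) : option W :=
  if (x == r) || (g (parent G x) != g x) then Some (g x) else None.

Section Labels.
Variables (S T0 : tree) (r : S) (G : forest S).
Hypothesis lS : layout r G.
Variable g : {ffun S -> T0}.
Hypothesis gc : contractionb g.

Local Notation lab := (entry_label r G g).

Let uG : uniq (flat G). Proof. by case: lS. Qed.
Let allG x : x \in flat G. Proof. by case: lS. Qed.

Lemma entry_label_val x v : lab x = Some v -> g x = v.
Proof. by rewrite /entry_label; case: ifP => // _ [->]. Qed.

(** A connected set that contains x but not the parent of x stays below x. *)
Lemma entry_label_anc x y v : lab x = Some v -> g y = v -> anc G x y.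
Proof.
move=> labx gy; have gx := entry_label_val labx.
have xv : x \in g @^-1: [set v] by rewrite !inE gx.
have yv : y \in g @^-1: [set v] by rewrite !inE gy.
have /andP[_ /forallP/(_ v)/andP[_ /forallP/(_ (Sub x xv))/forallP/(_ (Sub y yv))]] := gc.
set e := induced _ _ => cxy.
have symc : symmetric e by move=> a b; rewrite /e /induced adj_sym.
(* Within the fibre over v, no edge leaves the descendants of x. *)
have cl : closed e [pred w | anc G x (val w)].
  apply: (intro_closed (sym_connect_sym symc)) => a b ab /= xa.
  case: (adj_parent lS ab) => [[ar E]|[br E]]; rewrite inE /=; last first.
    by apply: (anc_trans uG xa); rewrite E (parent_anc lS).
  rewrite E (anc_parent lS) // [anc _ _ _]xa /=; apply/eqP => xaE.
  move: labx; rewrite /entry_label xaE (negPf ar) /=.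
  have /[!inE]/eqP -> := valP a; have := valP b; rewrite E inE inE => /eqP ->.
  by rewrite eqxx.
by have := closed_connect cl cxy; rewrite !inE /= anc_refl.
Qed.

Lemma entry_label_inj x y v : lab x = Some v -> lab y = Some v -> x = y.
Proof.
move=> lx ly; apply: (anc_antisym uG).
  exact: entry_label_anc lx (entry_label_val ly).
exact: entry_label_anc ly (entry_label_val lx).
Qed.

Lemma entry_label_surj v : exists x, lab x = Some v.
Proof.
have [x gx] := contraction_surj gc v.
elim/(layout_ind lS): x gx => [gr|x xr IHx gx].
  by exists r; rewrite /entry_label eqxx gr.
have [E|gpx] := eqVneq (g (parent G x)) (g x); first by apply: IHx; rewrite E.
by exists x; rewrite /entry_label gpx orbT gx.
Qed.

End Labels.

Section LabelledRetraction.
Variables (T S T0 : tree) (rT : T) (rS : S) (F : forest T) (G : forest S).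
Hypotheses (lT : layout rT F) (lS : layout rS G).
Variables (f : {ffun T -> T0}) (g : {ffun S -> T0}).
Hypotheses (fc : contractionb f) (gc : contractionb g).
Variable phi : T -> S.
Hypothesis anc_phi : forall x y, anc G (phi x) (phi y) = anc F x y.
Hypothesis lab_phi : forall x, entry_label rT F f x = entry_label rS G g (phi x).

(** The vertex of T with label v is sent to a vertex of S with label v, and there
is only one. *)
Lemma entry_phi s v : entry_label rS G g s = Some v -> exists t, phi t = s.
Proof.
move=> ls; have [t lt] := entry_label_surj lT fc v; exists t.
by apply: (entry_label_inj lS gc _ ls); rewrite -lab_phi.
Qed.

(** The root of S is labelled, hence is some phi t, which is below phi rT. *)
Lemma phi_root : phi rT = rS.
Proof.
have [|t phit] := @entry_phi rS (g rS); first by rewrite /entry_label eqxx.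
have uG : uniq (flat G) by case: lS.
apply: (anc_antisym uG); last exact: (anc_root lS).
by rewrite -phit anc_phi (anc_root lT).
Qed.

(** By induction from the root. At a vertex without a label, g takes the value of
the parent, and so does f along the retraction. A vertex with a label is in the
image of phi, where the labels determine both values. *)
Lemma label_retract s : f (retract rT F G phi s) = g s.
Proof.
elim/(layout_ind lS): s => [|s sr IHs].
  rewrite -phi_root (retract_phi lT lS anc_phi phi_root).
  have := lab_phi rT; rewrite phi_root /entry_label !eqxx /= => -[fr].
  by rewrite fr.
case ls: (entry_label rS G g s) => [v|].
  have [t phit] := entry_phi ls; rewrite -phit (retract_phi lT lS anc_phi phi_root).
  move: ls; rewrite -phit => ls; rewrite (entry_label_val ls).
  by rewrite -lab_phi in ls; apply: entry_label_val ls.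
have gp : g (parent G s) = g s.
  by move: ls; rewrite /entry_label (negPf sr) /=; case: eqP.
case: (pickP (fun t => phi t == s)) => [t /eqP E|ns]; last first.
  by rewrite -(retract_parent lT lS anc_phi phi_root sr) ?IHs // => t; rewrite ns.
have tr : t != rT by apply: contraNneq sr => tr; rewrite -E tr phi_root.
rewrite -gp -IHs -E (retract_phi lT lS anc_phi phi_root).
rewrite (retract_parent_phi lT lS anc_phi phi_root) //.
move: ls; rewrite -E -lab_phi /entry_label (negPf tr) /=.
by case: eqP.
Qed.

End LabelledRetraction.

(** * The lexicographic order on maps *)

Section LexicographicOrder.
Variables (V : finType) (W : finType) (F : forest V).

(** The first vertex where f and g differ, in depth-first order, decides. *)
Definition lexlt (f g : V -> W) : bool :=
  [exists t, (enum_rank (f t) < enum_rank (g t))%N &&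
    [forall u, (index u (flat F) < index t (flat F))%N ==> (f u == g u)]].

Lemma lexltP f g : reflect (exists2 t, (enum_rank (f t) < enum_rank (g t))%N
    & forall u, (index u (flat F) < index t (flat F))%N -> f u = g u) (lexlt f g).
Proof.
apply: (iffP existsP) => [[t /andP[lt /forallP H]]|[t lt H]]; exists t => //.
  by move=> u ltu; apply/eqP; apply: (implyP (H u)).
by rewrite lt; apply/forallP => u; apply/implyP => /H ->.
Qed.

Lemma lexlt_irr f : lexlt f f = false.
Proof. by apply/lexltP => -[t]; rewrite ltnn. Qed.

Hypothesis allF : forall x, x \in flat F.

Lemma lexlt_trans : transitive lexlt.
Proof.
move=> g f h /lexltP[t ltt eqt] /lexltP[u ltu equ]; apply/lexltP.
have [tu|ut|/(index_inj t (allF t) (allF u)) E] :=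
  ltngtP (index t (flat F)) (index u (flat F)).
- exists t => [|v vt]; first by rewrite -equ.
  by rewrite eqt // equ // (ltn_trans vt).
- exists u => [|v vu]; first by rewrite eqt.
  by rewrite eqt ?equ // (ltn_trans vu).
- exists t => [|v vt]; first by rewrite (ltn_trans ltt) // E.
  by rewrite eqt // equ // -E.
Qed.

Lemma lexlt_total f g : f =1 g \/ lexlt f g \/ lexlt g f.
Proof.
case: (pickP (fun x => f x != g x)) => [x0 nx0|E]; last first.
  by left=> x; have /negbT := E x; rewrite negbK => /eqP.
right; case: (@arg_minnP _ x0 (fun x => f x != g x)
  (fun x => index x (flat F)) nx0) => t nt tmin.
have eqt u : (index u (flat F) < index t (flat F))%N -> f u = g u.
  by move=> ltu; apply: contraTeq ltu => /tmin; rewrite -leqNgt.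
have [lt|gt|/val_inj/enum_rank_inj E] := ltngtP (enum_rank (f t)) (enum_rank (g t)).
- by left; apply/lexltP; exists t.
- by right; apply/lexltP; exists t => // u /eqt.
- by rewrite E eqxx in nt.
Qed.

End LexicographicOrder.

(** If f' and f first differ at t, then f' o h and f o h first differ at phi t: a
vertex s before phi t has phi (h s) above s, hence h s comes before t. *)
Lemma lexlt_retract (T S : tree) (W : finType) (rT : T) (rS : S)
    (F : forest T) (G : forest S) (phi : T -> S) (f f' : T -> W) :
  layout rT F -> layout rS G -> (forall x y, anc G (phi x) (phi y) = anc F x y) ->
  phi rT = rS -> subseq (map phi (flat F)) (flat G) -> lexlt F f' f ->
  lexlt G (f' \o retract rT F G phi) (f \o retract rT F G phi).
Proof.
move=> lT lS ancphi phir sub /lexltP[t ltt eqt]; apply/lexltP.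
have uG : uniq (flat G) by case: lS.
have allF x : x \in flat F by case: lT.
have phiI := phi_inj lT lS ancphi phir.
exists (phi t) => [|u ut]; rewrite /= ?(retract_phi lT lS ancphi phir) //.
apply: eqt; rewrite -!(index_map phiI).
rewrite -(subseq_index sub uG) ?map_f //; apply: leq_ltn_trans ut.
by apply: (anc_index uG); rewrite -(anc_retract lT lS) // anc_refl.
Qed.

(** * Domination of contractions to a fixed tree *)

Definition chosen_layout (T : tree) (r : T) : forest T := sval (cid (exists_layout r)).

Lemma chosen_layoutP (T : tree) (r : T) : layout r (chosen_layout r).
Proof. exact: svalP (cid (exists_layout r)). Qed.

Record pointed_contraction (T0 : tree) := PointedContraction {
  source : tree;
  base : source;
  target_map : contraction source T0 }.

(** Reading a as a monomial, b is one of its multiples: the quotient h preserves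
base points and is compatible with the lexicographic orders. *)
Definition dominated (T0 : tree) (a b : pointed_contraction T0) : Prop :=
  exists h : contraction (source b) (source a),
  [/\ val h (base b) = base a, target_map b = contraction_comp (target_map a) h
    & forall f : contraction (source a) T0,
      lexlt (chosen_layout (base a)) (val f) (val (target_map a)) ->
      lexlt (chosen_layout (base b)) (val (contraction_comp f h)) (val (target_map b))].

(** Kruskal's theorem, applied to the entry labels, gives the embedding whose
retraction is the contraction looked for. *)
Theorem good_dominated (T0 : tree) : good (@dominated T0).
Proof.
move=> a.
pose F n := chosen_layout (base (a n)).
pose lab n := entry_label (base (a n)) (F n) (val (target_map (a n))).
have [i [j [ij]]] := kruskal (@good_finite (option T0)) (fun n => fmap (lab n) (F n)).
move=> /emb_fmap/(emb_order (fun=> base (a j))).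
have lT := chosen_layoutP (base (a i)); have lS := chosen_layoutP (base (a j)).
have [[_ uT allT _] [_ uS _ _]] := (lT, lS).
case/(_ uT uS) => phi [sub labphi0 ancphi0].
have labphi x : lab i x = lab j (phi x) by apply: labphi0.
have ancphi x y : anc (F j) (phi x) (phi y) = anc (F i) x y.
  exact: ancphi0.
have fc := valP (target_map (a i)); have gc := valP (target_map (a j)).
have phir := phi_root lT lS fc gc ancphi labphi.
exists i, j; split=> //.
exists (exist (fun f => contractionb f) _ (retract_contraction lT lS ancphi phir)).
have mapE : val (target_map (a j)) =
    [ffun s => val (target_map (a i)) (retract (base (a i)) (F i) (F j) phi s)].
 
  by apply/ffunP => s; rewrite ffunE (label_retract lT lS fc gc ancphi labphi).
split=> [||f flt].
- by rewrite /= ffunE -[X in retract _ _ _ _ X]phir (retract_phi lT lS ancphi phir).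
- by apply: val_inj; rewrite mapE; apply/ffunP => s; rewrite !ffunE.
- have := lexlt_retract lT lS ancphi phir sub flt; rewrite mapE /=.
  by congr lexlt; apply/funext => s /=; rewrite !ffunE.
Qed.

(** * Noetherian modules over a category *)

Import GRing.Theory.
Local Open Scope ring_scope.

(** The ascending chain condition for the ideals generated by c 0, ..., c (n - 1):
their union is an ideal, whose finitely many generators all lie in one of
them. Quantification over the ideals that contain these elements stands for
membership in the ideal that they generate. *)
Lemma noetherian_sequence (k : comPzRingType) (c : nat -> k) : noetherian_ring k ->
  exists n, forall I, ideal I -> (forall i, (i < n)%N -> I (c i)) -> I (c n).
Proof.
move=> noeth.
(* The ideal generated by c 0, ..., c (n - 1). *)
pose J n a := forall I, ideal I -> (forall i, (i < n)%N -> I (c i)) -> I a.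
have idJ n : ideal (J n).
  split=> [I [I0 _ _]|a b Ja Jb I idI Ic|d a Ja I idI Ic] //.
    by case: (idI) => _ ID _; apply: ID; [apply: Ja | apply: Jb].
  by case: (idI) => _ _ IM; apply: IM; apply: Ja.
have leJ m n a : (m <= n)%N -> J m a -> J n a.
  by move=> mn Ja I idI Ic; apply: Ja => // i im; apply: Ic; apply: leq_trans mn.
have [|m [g [gJ gen]]] := noeth (fun a => exists n, J n a).
  split=> [|a b [m Ja] [n Jb]|d a [n Ja]].
  - by exists 0; case: (idJ 0).
  - exists (maxn m n); case: (idJ (maxn m n)) => _ JD _.
    by apply: JD; [apply: leJ Ja; apply: leq_maxl | apply: leJ Jb; apply: leq_maxr].
  - by exists n; case: (idJ n) => _ _; apply.
have [N gN] := choice gJ; exists (\max_i N i)%N.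
have [|d ->] := gen (c (\max_i N i)%N).
  by exists (\max_i N i).+1 => I _; apply.
case: (idJ (\max_i N i)%N) => J0 JD JM.
by apply: (big_ind _ J0 JD) => i _; apply: JM; apply: leJ (gN i); apply: leq_bigmax.
Qed.

Section NoetherianModules.
Variables (k : comPzRingType) (C : category).
Implicit Types (M : cmodule k C).

(** Submodules as predicates, so that they can be intersected and pulled back
without constructing modules. *)
Definition is_submodule M (N : forall x, M x -> Prop) : Prop :=
  [/\ forall x, N x 0, forall x a u v, N x u -> N x v -> N x (a *: u + v)
    & forall x y (f : hom x y) v, N x v -> N y (act M f v)].

Definition element M := {x : C & M x}.
Definition Element M x (v : M x) : element M := existT (fun x => M x : Type) x v.

Definition contains M (N : forall x, M x -> Prop) (es : seq (element M)) : Prop :=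
  List.Forall (fun e => N (tag e) (tagged e)) es.

(** That es generates N is said impredicatively, by testing N against all
submodules that contain es. *)
Definition noetherian_module M : Prop :=
  forall N : forall x, M x -> Prop, is_submodule N ->
  exists2 es, contains N es &
    forall N' : forall x, M x -> Prop, is_submodule N' -> contains N' es ->
    forall x v, N x v -> N' x v.

Section Submodule.
Variables (M : cmodule k C) (N : forall x, M x -> Prop).
Hypothesis sN : is_submodule N.

Lemma submodule_add x (u v : M x) : N u -> N v -> N (u + v).
Proof. by case: sN => _ NL _ Nu Nv; rewrite -[u]scale1r; apply: NL. Qed.

Lemma submodule_scale x a (u : M x) : N u -> N (a *: u).
Proof. by case: sN => N0 NL _ Nu; rewrite -[_ *: _]addr0; apply: NL. Qed.

Lemma submodule_sub x (u v : M x) : N u -> N v -> N (u - v).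
Proof.
move=> Nu Nv; apply: submodule_add => //.
by rewrite -scaleN1r; apply: submodule_scale.
Qed.
End Submodule.

Lemma noetherian_zero : noetherian_module (cmod_zero k C).
Proof.
move=> N [N0 _ _]; exists [::] => [|N' [N'0 _ _] _ x v _]; first exact: List.Forall_nil.
by rewrite (_ : v = 0) //; apply/matrixP => i [].
Qed.

Lemma Forall_map (S T : Type) (f : S -> T) (P : T -> Prop) (s : seq S) :
  List.Forall P (map f s) <-> List.Forall (fun x => P (f x)) s.
Proof. exact: List.Forall_map. Qed.

(** The usual extension argument: generators of the intersection of N with M1,
together with lifts of generators of the image of N in M2. *)
Lemma noetherian_dsum M1 M2 :
  noetherian_module M1 -> noetherian_module M2 -> noetherian_module (dsum M1 M2).
Proof.
move=> noeth1 noeth2 N sN; have [N0 NL NA] := sN.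
pose N1 x (a : M1 x) := N x (a, 0).
pose N2 x (b : M2 x) := exists a, N x (a, b).
have sub1 (N' : forall x, dsum M1 M2 x -> Prop) : is_submodule N' ->
    @is_submodule M1 (fun x a => N' x (a, 0)).
  case=> N'0 N'L N'A; split=> [x|x a u v Nu Nv|x y f v Nv]; first exact: N'0.
    by have := N'L _ a _ _ Nu Nv; congr N'; congr pair; rewrite /= scaler0 addr0.
  by have := N'A _ _ f _ Nv; congr N'; congr pair; rewrite /= linear0.
have [es1 es1N gen1] := noeth1 N1 (sub1 _ sN).
have sub2 (N' : forall x, dsum M1 M2 x -> Prop) : is_submodule N' ->
    @is_submodule M2 (fun x b => exists a, N' x (a, b)).
  case=> N'0 N'L N'A; split=> [x|x a u v [u' Nu] [v' Nv]|x y f v [v' Nv]].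
  - by exists 0; apply: N'0.
  - by exists (a *: u' + v'); apply: (N'L _ a _ _ Nu Nv).
  - by exists (act M1 f v'); apply: (N'A _ _ f _ Nv).
have [es2 es2N gen2] := noeth2 N2 (sub2 _ sN).
have [es2' [es2'N es2'E]] : exists es2' : seq (element (dsum M1 M2)),
    contains N es2' /\
    map (fun e : element (dsum M1 M2) => @Element M2 _ (tagged e).2) es2' = es2.
  elim: es2 es2N {gen2} => [|[x b] es2 IH] H.
    by exists [::]; split; first exact: List.Forall_nil.
  inversion H as [|e' es' [a ab] H']; subst.
  have [es2' [es2'N <-]] := IH H'.
  by exists (@Element (dsum M1 M2) x (a, b) :: es2'); split=> //; apply: List.Forall_cons.
exists (map (fun e : element M1 => @Element (dsum M1 M2) _ (tagged e, 0)) es1 ++ es2').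
  by apply/List.Forall_app; split=> //; apply/Forall_map.
move=> N' sN' /List.Forall_app[/Forall_map c1 c2] x [a b] Nab.
have [a' [Na'b N'a'b]] : exists a', N x (a', b) /\ N' x (a', b).
  have sNN : is_submodule (fun x v => N x v /\ N' x v).
    have [N'0 N'L N'A] := sN'; split=> [y|y c u v [? ?] [? ?]|y z f v [? ?]]; split; auto.
  have := gen2 _ (sub2 _ sNN); apply; last by exists a.
  rewrite -es2'E; apply/Forall_map.
  apply: List.Forall_impl (List.Forall_and es2'N c2) => -[y [u v]] /=.
  by exists u.
have -> : ((a, b) : dsum M1 M2 x) = (a - a', 0) + (a', b).
  by congr pair; rewrite /= ?subrK ?add0r.
apply: (submodule_add sN') => //; apply: (gen1 _ (sub1 _ sN') c1).
have := submodule_sub sN Nab Na'b; rewrite /N1; congr N; congr pair.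
by rewrite /= subrr.
Qed.

Section Morphisms.
Variables (M M' : cmodule k C) (u : cmod_hom M M').

Lemma preimage_submodule (N : forall x, M' x -> Prop) :
  is_submodule N -> is_submodule (fun x v => N x (u x v)).
Proof.
case=> N0 NL NA; split=> [x|x a v w Nv Nw|x y f v Nv].
- by rewrite linear0.
- by rewrite linearP; apply: NL.
- by rewrite naturality; apply: NA.
Qed.

Lemma image_submodule (N : forall x, M x -> Prop) :
  is_submodule N -> is_submodule (fun x w => exists2 v, N x v & u x v = w).
Proof.
case=> N0 NL NA; split=> [x|x a _ _ [v Nv <-] [w Nw <-]|x y f _ [v Nv <-]].
- by exists 0; rewrite ?linear0.
- by exists (a *: v + w); rewrite ?linearP //; apply: NL.
- by exists (act M f v); rewrite ?naturality //; apply: NA.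
Qed.

Lemma full_submodule : is_submodule (fun x (v : M x) => True).
Proof. by []. Qed.

Lemma noetherian_quotient :
  cmod_surjective u -> noetherian_module M -> noetherian_module M'.
Proof.
move=> surj noeth N sN; have [es esN gen] := noeth _ (preimage_submodule sN).
exists (map (fun e : element M => Element (u _ (tagged e))) es).
  exact/Forall_map.
move=> N' sN' /Forall_map c' x w; have [v <-] := surj x w.
exact: (gen _ (preimage_submodule sN')).
Qed.

End Morphisms.

Section Yoneda.
Variables (M : cmodule k C) (x : C) (v : M x).

Definition yoneda_fun (y : C) (a : principal k x y) : M y :=
  \sum_f a f *: act M f v.

Fact yoneda_is_linear y : linear (@yoneda_fun y).
Proof.
move=> c a b; rewrite /yoneda_fun scaler_sumr -big_split /=.
by apply: eq_bigr => f _; rewrite !ffunE scalerDl scalerA.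
Qed.

HB.instance Definition _ y := GRing.isLinear.Build k (principal k x y) (M y) _
  (@yoneda_fun y) (@yoneda_is_linear y).

Fact yoneda_natural y z (g : hom y z) (a : principal k x y) :
  yoneda_fun (act (principal k x) g a) = act M g (yoneda_fun a).
Proof.
rewrite /yoneda_fun linear_sum (partition_big (comp g) predT) //=.
apply: eq_bigr => h _; rewrite ffunE scaler_suml.
by apply: eq_bigr => f /eqP <-; rewrite linearZ actM.
Qed.

Definition yoneda : cmod_hom (principal k x) M :=
  @CModHom k C (principal k x) M (fun y => @yoneda_fun y) yoneda_natural.

Lemma yoneda_id : yoneda x [ffun f => (f == idm x)%:R] = v.
Proof.
rewrite /= /yoneda_fun (bigD1 (idm x)) //= big1 => [|f nf].
  by rewrite ffunE eqxx act1 scale1r addr0.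
by rewrite ffunE (negPf nf) scale0r.
Qed.

End Yoneda.

Section Copair.
Variables (M1 M2 M : cmodule k C) (u1 : cmod_hom M1 M) (u2 : cmod_hom M2 M).

Definition copair_fun (x : C) (v : dsum M1 M2 x) : M x := u1 x v.1 + u2 x v.2.

Fact copair_is_linear x : linear (@copair_fun x).
Proof. by move=> c a b; rewrite /copair_fun /= !linearP scalerDr addrACA. Qed.

HB.instance Definition _ x := GRing.isLinear.Build k (dsum M1 M2 x) (M x) _
  (@copair_fun x) (@copair_is_linear x).

Fact copair_natural x y (f : hom x y) (v : dsum M1 M2 x) :
  copair_fun (act (dsum M1 M2) f v) = act M f (copair_fun v).
Proof. by rewrite /copair_fun /= !naturality linearD. Qed.

Definition copair : cmod_hom (dsum M1 M2) M :=
  @CModHom k C (dsum M1 M2) M (fun x => @copair_fun x) copair_natural.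

End Copair.

Fact zero_hom_natural M x y (f : hom x y) (v : cmod_zero k C x) :
  (\0 : {linear cmod_zero k C y -> M y}) (act (cmod_zero k C) f v) =
  act M f ((\0 : {linear cmod_zero k C x -> M x}) v).
Proof. by rewrite linear0. Qed.

Definition zero_hom M : cmod_hom (cmod_zero k C) M :=
  @CModHom k C (cmod_zero k C) M (fun x => \0) (@zero_hom_natural M).

(** The direct sum of the Yoneda morphisms of the elements of es. *)
Lemma generated_by (M : cmodule k C) (es : seq (element M)) :
  exists u : cmod_hom (direct_sum (map (@principal k C) (map (fun e => tag e) es))) M,
  List.Forall (fun e => exists a, u (tag e) a = tagged e) es.
Proof.
elim: es => [|e es [u uP]] /=; first by exists (zero_hom M); apply: List.Forall_nil.
exists (copair (yoneda (tagged e)) u); apply: List.Forall_cons.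
  eexists (_, 0); rewrite /= /copair_fun /= linear0 addr0; apply: yoneda_id.
apply: List.Forall_impl uP => e' [a ae]; exists (0, a).
by rewrite /= /copair_fun /= ae [yoneda_fun _ _](linear0) add0r.
Qed.

(** Generators of the image of N in M lift to N, where they still generate
because i is injective. *)
Lemma noetherian_submodule_fg M N (i : cmod_hom N M) :
  noetherian_module M -> cmod_injective i -> finitely_generated N.
Proof.
move=> noeth inji; have [es esN gen] := noeth _ (image_submodule i (@full_submodule N)).
have [fs fsE] : exists fs : seq (element N),
    map (fun e => Element (i _ (tagged e))) fs = es.
  elim: es esN {gen} => [|[x w] es IH] H; first by exists [::].
  inversion H as [|e' es' [v _ vw] H']; subst; have [fs <-] := IH H'.
  by exists (Element v :: fs); rewrite /= vw.
have [u uP] := generated_by fs; exists (map (fun e => tag e) fs), u => x w.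
pose U := fun x w => exists2 v : N x, (exists a, u x a = v) & i x v = w.
have sU : is_submodule U.
  have := image_submodule i (image_submodule u (@full_submodule _)).
  case=> U0 UL UA.
  have UE y w' : U y w' <-> exists2 v, exists2 a, True & u y a = v & i y v = w'.
    split=> -[v [a]]; first by move=> ua iv; exists v => //; exists a.
    by move=> _ ua iv; exists v => //; exists a.
  split=> [y|y c v v' /UE Uv /UE Uv'|y z f v /UE Uv].
  - exact/UE/U0.
  - exact/UE/UL.
  - exact/UE/UA.
have [||v [a <-] /inji <-] := gen U sU _ x (i x w); last by exists a.
  rewrite -fsE; apply/Forall_map; apply: List.Forall_impl uP => e [a ua] /=.
  by exists (tagged e) => //; exists a.
by exists w.
Qed.

Lemma noetherian_rep : (forall x : C, noetherian_module (principal k x)) ->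
  rep_locally_noetherian k C.
Proof.
move=> noethP M N i [xs [u usurj]] inji.
apply: noetherian_submodule_fg inji; apply: noetherian_quotient usurj _.
elim: xs {u} => [|x xs IH] /=; first exact: noetherian_zero.
exact: noetherian_dsum.
Qed.

End NoetherianModules.

(** * Groebner bases in a principal projective *)

Lemma In_mkseq (T : Type) (f : nat -> T) n x :
  List.In x (mkseq f n) <-> exists2 i, (i < n)%N & f i = x.
Proof.
elim: n => [|n IHn]; first by split=> // -[].
have E (s : seq T) y : List.In x (rcons s y) <-> List.In x s \/ y = x.
  by elim: s => [|z s IHs] /=; tauto.
rewrite mkseqS E IHn; split=> [[[i lt_in <-]|<-]|[i + fi]].
- by exists i => //; apply: ltnW.
- by exists n.
by rewrite ltnS leq_eqVlt => /orP[/eqP <-|lt_in]; [right | left; exists i].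
Qed.

Section Groebner.
Variables (k : comPzRingType) (C : category) (x : C).
Variable lt : forall y : C, rel (hom x y).

(** Besides being a multiple of a, the monomial b has to be the leading one among
the multiples by h of the monomials up to a; this makes leading coefficients
multiplicative. *)
Definition divides (a b : {y : C & hom x y}) : Prop :=
  exists h : hom (tag a) (tag b), comp h (tagged a) = tagged b /\
    forall f, lt f (tagged a) -> lt (comp h f) (tagged b).

Hypothesis noeth : noetherian_ring k.
Hypothesis lt_irr : forall y (f : hom x y), lt f f = false.
Hypothesis lt_trans : forall y, transitive (@lt y).
Hypothesis lt_total : forall y (f g : hom x y), f = g \/ lt f g \/ lt g f.
Hypothesis good_divides : good divides.

(** A vector together with a candidate for its leading monomial; [in_bv] asks this
monomial to bound the support. The coefficient at it may vanish, so that the leading coefficients together with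
zero need no separate treatment. *)
Record bounded_vector := BoundedVector {
  bv_monomial : {y : C & hom x y};
  bv_vector : principal k x (tag bv_monomial) }.

Local Notation mono := bv_monomial.
Local Notation coef t := (bv_vector t (tagged (mono t)) : k).

Definition bounded y (f : hom x y) (v : principal k x y) : Prop :=
  forall g, lt f g -> v g = 0.

Variable N : forall y, principal k x y -> Prop.
Hypothesis sN : is_submodule N.

Definition in_bv (t : bounded_vector) : Prop :=
  N (bv_vector t) /\ bounded (tagged (mono t)) (bv_vector t).

(** The coefficient of t at its monomial lies in the ideal generated by the
coefficients of those members of s whose monomials divide that of t. *)
Definition reducible (s : seq bounded_vector) (t : bounded_vector) : Prop :=
  forall I : k -> Prop, ideal I ->
  (forall t', List.In t' s -> divides (mono t') (mono t) -> I (coef t')) ->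
  I (coef t).

(** Otherwise one could keep choosing vectors that the previous ones do not
reduce. Along a subsequence with ascending monomials, no coefficient would be
in the ideal generated by the previous ones. *)
Lemma exists_basis : exists2 s : seq bounded_vector,
  List.Forall in_bv s & forall t, in_bv t -> reducible s t.
Proof.
apply: contrapT => nbasis.
have [y0 [f0 _]] : exists y (f : hom x y), True by exists x, (idm x).
have [|t tP] := @history_choice bounded_vector (fun s t => List.Forall in_bv s ->
    in_bv t /\ ~ reducible s t).
  move=> s; case: (pselect (List.Forall in_bv s)) => [sN'|]; last first.
    by exists (@BoundedVector (existT _ y0 f0) 0).
  apply: contrapT => nt; apply: nbasis; exists s => // t tN; apply: contrapT => nred.
  by apply: nt; exists t.
have tN n : in_bv (t n).
  have [m] := ubnP n; elim: m n => // m IHm n; rewrite ltnS => nm.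
  apply: (tP n _).1; apply/List.Forall_forall => _ /In_mkseq[i lt_in <-].
  exact: IHm (leq_trans lt_in nm).
have nred n : ~ reducible (mkseq t n) (t n).
  by apply: (tP n _).2; apply/List.Forall_forall => _ /In_mkseq[i _ <-].
have [s sP] := good_ascending (fun n => mono (t n)) good_divides.
have [n nP] := noetherian_sequence (fun i => coef (t (s i))) noeth.
apply: (nred (s n)) => I idI It; apply: nP => // i lt_in.
have [sin din] := sP _ _ lt_in.
by apply: It din; apply/In_mkseq; exists (s i).
Qed.

(** Multiplication by h keeps the monomials of v other than f strictly below g,
and so carries the leading coefficient over. *)
Lemma act_coef y z (h : hom y z) (f : hom x y) (g : hom x z) (v : principal k x y) :
  comp h f = g -> (forall f', lt f' f -> lt (comp h f') g) -> bounded f v ->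
  bounded g (act (principal k x) h v) /\ act (principal k x) h v g = v f.
Proof.
move=> hf hlt vf; split=> [g' gg'|].
  rewrite ffunE big1 // => f' /eqP hf'; have [E|[lt_f'f|/vf //]] := lt_total f' f.
    by rewrite -hf' E hf lt_irr in gg'.
  by have := lt_trans gg' (_ : lt g' g); rewrite lt_irr -hf' hlt // => /(_ isT).
rewrite ffunE (bigD1 f) ?hf //= big1 ?addr0 // => f' /andP[/eqP hf' nf'].
have [E|[/hlt|/vf //]] := lt_total f' f; first by rewrite E eqxx in nf'.
by rewrite hf' lt_irr.
Qed.

(** By induction on the position of the leading monomial g of w. The values at g of
the common elements of N and N' that are bounded by g form an ideal, which
contains w g as w is reducible; subtracting from w an element with the same
value at g lowers the leading monomial. *)
Lemma basis_generates (s : seq bounded_vector) (N' : forall y, principal k x y -> Prop) :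
  (forall t, in_bv t -> reducible s t) -> List.Forall in_bv s ->
  is_submodule N' -> (forall t, List.In t s -> N' (tag (mono t)) (bv_vector t)) ->
  forall z w, N w -> N' z w.
Proof.
move=> red sN0 sN' N's z w Nw.
have [N0 NL NA] := sN; have [N'0 N'L N'A] := sN'.
suff H n (w' : principal k x z) : N w' ->
    (forall g, w' g != 0 -> (#|[pred f | lt f g]| < n)%N) -> N' z w'.
  by apply: (H #|{: hom x z}|.+1 w Nw) => g _; rewrite ltnS max_card.
elim: n w' {w Nw} => [|n IHn] w Nw wn.
  rewrite (_ : w = 0) //; apply/ffunP => g; rewrite ffunE; apply/eqP.
  by apply: contraT => /wn.
have card_lt (g g' : hom x z) : lt g g' ->
    (#|[pred f | lt f g]| < #|[pred f | lt f g']|)%N.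
  move=> gg'; apply: proper_card; apply/properP; split.
    by apply/subsetP => f; rewrite !inE => /lt_trans; apply.
  by exists g; rewrite !inE ?lt_irr.
(* A monomial of w that has n predecessors is the leading one. *)
case: (pickP (fun g => (w g != 0) && (#|[pred f | lt f g]| == n)))
  => [g /andP[wg /eqP gn]|nog];
    last first.
  apply: IHn => // g wg; have := wn g wg; rewrite ltnS leq_eqVlt => /orP[|//] gn.
  by have := nog g; rewrite wg gn.
have bg : bounded g w.
  move=> g' /card_lt; rewrite gn => ng'; apply/eqP; apply: contraT => /wn.
  by rewrite ltnS leqNgt ng'.
pose I c := exists u : principal k x z, [/\ N u, N' z u, bounded g u & u g = c :> k].
have [u [Nu N'u bu ug]] : I (w g).
  apply: (red (@BoundedVector (existT _ z g) w)) => //=.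
    split=> [|_ _ [u [? ? bu <-]] [v [? ? bv <-]]|c _ [u [? ? bu <-]]].
    - by exists 0; split=> // [g' _|]; rewrite ffunE.
    - exists (u + v); split; try exact: submodule_add.
        by move=> g' gg'; rewrite ffunE bu ?bv // addr0.
      by rewrite ffunE.
    - exists (c *: u); split; try exact: submodule_scale.
        by move=> g' gg'; rewrite ffunE bu // scaler0.
      by rewrite ffunE.
  move=> t ts [h /= [hf hlt]].
  have [Nt bt] : in_bv t by move/List.Forall_forall: sN0; apply.
  have [bht htg] := act_coef hf hlt bt.
  exists (act (principal k x) h (bv_vector t)); split=> //; first exact: NA.
  by apply: N'A; apply: N's.
rewrite -(subrK u w); apply: submodule_add => //; apply: IHn.
  exact: submodule_sub.
move=> g' ng'; rewrite -gn; apply: card_lt.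
have [E|[//|gg']] := lt_total g' g; move: ng'; rewrite !ffunE.
  by rewrite E ug subrr eqxx.
by rewrite bg // bu // subrr eqxx.
Qed.

End Groebner.

Theorem groebner_noetherian (k : comPzRingType) (C : category) (x : C)
    (lt : forall y : C, rel (hom x y)) : noetherian_ring k ->
  (forall y (f : hom x y), lt y f f = false) ->
  (forall y, transitive (lt y)) ->
  (forall y (f g : hom x y), f = g \/ lt y f g \/ lt y g f) ->
  good (divides lt) ->
  noetherian_module (principal k x).
Proof.
move=> noeth irr tr tot gd N sN.
have [s sN0 red] := exists_basis noeth gd N.
exists (map (fun t => Element (bv_vector t)) s).
  by apply/Forall_map; apply: List.Forall_impl sN0 => t [].
move=> N' sN' /Forall_map c z w; apply: (basis_generates irr tr tot sN red sN0 sN').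
exact/List.Forall_forall.
Qed.

(** * The three categories of trees *)

Section TreeCategories.
Variables (k : comPzRingType) (C : category) (x : C) (T0 : tree).
Variables (S : C -> tree) (r : forall y, S y).
Variable m : forall y, hom x y -> contraction (S y) T0.

(** The common form of the three categories: a morphism from x to y is a
contraction from S y to T0, possibly with restrictions, and every contraction
that preserves the roots r acts as a morphism. The root is part of the data
of a rooted tree and is chosen arbitrarily in an unrooted one. *)
Lemma contractions_noetherian : noetherian_ring k ->
  (forall y, injective (@m y)) ->
  (forall y z (h : contraction (S z) (S y)), val h (r z) = r y ->
     exists h' : hom y z, forall f, m (comp h' f) = contraction_comp (m f) h) ->
  noetherian_module (principal k x).
Proof.
move=> noeth minj mlift.
pose lt y (f g : hom x y) := lexlt (chosen_layout (r y)) (val (m f)) (val (m g)).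
have all y v : v \in flat (chosen_layout (r y)) by case: (chosen_layoutP (r y)).
apply: (@groebner_noetherian k C x lt) => //.
- by move=> y f; apply: lexlt_irr.
- by move=> y g f h; apply: (@lexlt_trans _ _ _ (all y)).
- move=> y f g.
  have [E|] := lexlt_total (chosen_layout (r y)) (val (m f)) (val (m g)); last by right.
  by left; apply/minj/val_inj/ffunP.
move=> a; pose b n := PointedContraction (r (tag (a n))) (m (tagged (a n))).
have [i [j [ij [h [/= hr hm hlt]]]]] := good_dominated b.
have [h' h'P] := mlift _ _ h hr.
exists i, j; split=> //; exists h'; split; first by apply: minj; rewrite h'P hm.
by move=> f /hlt; rewrite /lt h'P.
Qed.

End TreeCategories.

Lemma tree_vertex (T : tree) : {x : T | true}.
Proof.
by apply: cid; case/andP: (tree_connected T) => /card_gt0P[x _] _; exists x.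
Qed.

Theorem theorem1p2 (k : comPzRingType) (l : nat) :
  noetherian_ring k -> (2 <= l)%N ->
  [/\ rep_locally_noetherian k (op trees),
      rep_locally_noetherian k (op rooted_trees)
    & rep_locally_noetherian k (op (trees_le l))].
Proof.
move=> noeth _; split; apply: noetherian_rep => T0.
- apply: (@contractions_noetherian k (op trees) T0 T0 id (fun y => sval (tree_vertex y))
    (fun y f => f)) => // [y f g //|y z h _].
  by exists h.
- apply: (@contractions_noetherian k (op rooted_trees) T0 T0 underlying_tree root_vertex
    (fun y f => val f)) => // [y|y z h hr]; first exact: val_inj.
  by exists (exist (fun h : contraction z y => val h (root_vertex z) == root_vertex y)
    h (introT eqP hr)).
- apply: (@contractions_noetherian k (op (trees_le l)) T0 (sval T0) (fun y => sval y)
    (fun y => sval (tree_vertex (sval y))) (fun y f => f)) => // [y f g //|y z h _].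
  by exists h.
Qed.
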